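(* Let $A\subset\mathbb{R}^p$ be a $d$-regular compact set, where $0<d\leqslant p$, and let $f$ be a $d$-Riesz-like function. For each positive integer $N$ let $\nu_N$ be an $N$-point normalized counting measure on $A$ that attains $\mathcal{P}_f(A,N)$. If $\nu^*$ is any weak$^*$-limit measure of the sequence $(\nu_N)$, then $\nu^*$ solves the continuous $f$-polarization problem, i.e. $\nu^*$ is a probability measure supported on $A$ with $\inf_{y\in A}U_f^{\nu^*}(y)=T_f(A)$.
   Context: $d$-regular: a nonempty compact set $A\subset\mathbb{R}^p$ is called $d$-regular, $0<d\leqslant p$, if there exist positive constants $c$ and $C$ such that for any $y\in A$ and any $r$ with $0<r<\operatorname{diam}(A)$ we have $cr^d\leqslant\mathcal{H}_d(B(y,r)\cap A)\leqslant Cr^d$. Here $\mathcal{H}_d$ is the $d$-dimensional Hausdorff measure on $\mathbb{R}^p$ normalized by $\mathcal{H}_d([0,1]^d)=1$, and $B(y,r)$ is the open ball in $\mathbb{R}^p$ with center $y$ and radius $r$. $d$-Riesz-like: a function $f\colon(0,\infty)\to(0,\infty)$ is called $d$-Riesz-like if it is continuous, strictly decreasing, and for some $\varepsilon$ with $0<\varepsilon<d$ and some $t_\varepsilon>0$ the function $t\mapsto t^{d-\varepsilon}f(t)$ is increasing on $[0,t_\varepsilon]$, where its value at $0$ is defined as $\lim_{t\to0^+}t^{d-\varepsilon}f(t)$. We set $f(0):=\lim_{t\to0^+}f(t)\in(0,\infty]$. Potential and polarization: for a positive Borel measure $\mu$ supported on $A$, $U_f^\mu(y):=\int_A f(|x-y|)\,\mathrm{d}\mu(x)$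 for $y\in\mathbb{R}^p$, and $P_f(\mu):=\inf_{y\in A}U_f^\mu(y)$. Discrete problem: an $N$-point multiset $\omega_N\subset A$ is a collection of $N$ points of $A$ counted with multiplicities; its normalized counting measure is $\nu_{\omega_N}:=\frac1N\sum_{x\in\omega_N}\delta_x$. The discrete $N$-th polarization (Chebyshev) constant is $\mathcal{P}_f(A,N):=\sup_{\omega_N\subset A}\inf_{y\in A}U_f^{\nu_{\omega_N}}(y)$, the supremum being over all $N$-point multisets $\omega_N\subset A$. An $N$-point normalized counting measure $\nu_N=\nu_{\omega_N}$ attains $\mathcal{P}_f(A,N)$ if $P_f(\nu_N)=\mathcal{P}_f(A,N)$. Continuous problem: $T_f(A):=\sup_\mu\inf_{y\in A}U_f^\mu(y)$, the supremum being over all Borel probability measures $\mu$ supported on $A$. A probability measure $\nu$ supported on $A$ solves the continuous $f$-polarization problem if $\inf_{y\in A}U_f^\nu(y)=T_f(A)$. Weak$^*$ convergence: $\mu_n\stackrel{*}{\to}\mu$ means that $\int\varphi\,\mathrm{d}\mu_n\to\int\varphi\,\mathrm{d}\mu$ for every function $\varphi$ continuous on $A$. A weak$^*$-limit measure of a sequence is the weak$^*$ limit of some subsequence. *)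

(* Defs.v *)
From HB Require Import structures.
From mathcomp Require Import all_boot all_order all_algebra.
From mathcomp Require Import all_classical all_reals all_analysis.

Set Implicit Arguments.
Unset Strict Implicit.
Unset Printing Implicit Defensive.

Import Order.TTheory GRing.Theory Num.Theory.
Import numFieldNormedType.Exports.

Local Open Scope classical_set_scope.
Local Open Scope ring_scope.
Local Open Scope ereal_scope.

(* R^p with its Borel sigma-algebra. The topology is the library's one on row
   vectors (that of the sup norm), hence the usual topology of R^p. *)
Notation borel_rV R p := (g_sigma_algebraType (@open 'rV[R]_p)).

(* The library's norm on matrices is the sup norm; the Euclidean distance has
   to be introduced. *)
Definition eucl_dist (R : realType) (p : nat) (x y : 'rV[R]_p) : R :=
  Num.sqrt (\sum_(i < p) (x ord0 i - y ord0 i) ^+ 2)%R.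

Definition eucl_ball (R : realType) (p : nat) (y : 'rV[R]_p) (r : R)
  : set 'rV[R]_p := [set x | (eucl_dist x y < r)%R].

(* The maximum with 0 gives the empty set diameter 0 (instead of -oo). *)
Definition eucl_diam (R : realType) (p : nat) (E : set 'rV[R]_p) : \bar R :=
  maxe 0 (ereal_sup [set (eucl_dist z.1 z.2)%:E | z in E `*` E]).

Definition hausdorff_pre (R : realType) (p : nat) (d delta : R)
    (E : set 'rV[R]_p) : \bar R :=
  ereal_inf [set \sum_(0 <= k <oo) (eucl_diam (U k) `^ d) |
    U in [set U : nat -> set 'rV[R]_p |
           E `<=` \bigcup_k U k /\ forall k, eucl_diam (U k) <= delta%:E]].

Definition hausdorff_raw (R : realType) (p : nat) (d : R) (E : set 'rV[R]_p)
  : \bar R :=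
  ereal_sup [set hausdorff_pre d delta E | delta in [set delta | (0 < delta)%R]].

(* [0,1]^n as a subset of R^p, for n <= p. *)
Definition unit_cube (R : realType) (p n : nat) : set 'rV[R]_p :=
  [set x | forall i : 'I_p, (0 <= x ord0 i <= (i < n)%N%:R)%R].

(* [0,1]^d only makes sense when d is an integer: no rescaling is done
   for other values of d. *)
Definition hausdorff_const (R : realType) (p : nat) (d : R) : R :=
  if d \is a Num.nat
  then fine (hausdorff_raw d (@unit_cube R p (Num.truncn d))) else 1%R.

(* The d-dimensional Hausdorff (outer) measure, with value 1 on [0,1]^d. *)
Definition hausdorff (R : realType) (p : nat) (d : R) (E : set 'rV[R]_p)
  : \bar R :=
  ((hausdorff_const p d)^-1)%:E * hausdorff_raw d E.

Definition d_regular (R : realType) (p : nat) (d : R) (A : set 'rV[R]_p)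
  : Prop :=
  [/\ A !=set0, compact A &
    exists c C : R, [/\ (0 < c)%R, (0 < C)%R &
      forall (y : 'rV[R]_p) (r : R), A y -> (0 < r)%R -> r%:E < eucl_diam A ->
        (c * r `^ d)%:E <= hausdorff d (eucl_ball y r `&` A) <= (C * r `^ d)%:E]].

(* Functions on ]0, +oo[ are represented by functions on R, whose values
   outside of ]0, +oo[ are never used. *)
Definition riesz_like (R : realType) (d : R) (f : R -> R) : Prop :=
  [/\ forall t : R, (0 < t)%R -> (0 < f t)%R,
      {in `]0%R, +oo[, continuous f},
      forall s t : R, (0 < s)%R -> (s < t)%R -> (f t < f s)%R &
      exists eps t_eps : R, [/\ (0 < eps < d)%R, (0 < t_eps)%R &
        let h := fun t : R => (t `^ (d - eps) * f t)%R in
        let g := fun t : R =>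
          if t == 0%R then lim (h s @[s --> 0%R^'+]) else h t in
        forall s t : R, (0 <= s)%R -> (s <= t)%R -> (t <= t_eps)%R ->
          (g s <= g t)%R]].

(* The extension of f to [0, +oo[ by f(0) := lim_(t -> 0+) f(t), which may be
   +oo. *)
Definition extend0 (R : realType) (f : R -> R) (t : R) : \bar R :=
  if t == 0%R then lim ((f s)%:E @[s --> 0%R^'+]) else (f t)%:E.

Section polarization.
Variables (R : realType) (p : nat) (A : set 'rV[R]_p) (f : R -> R).
Implicit Types mu nu : {measure set (borel_rV R p) -> \bar R}.

Definition potential mu (y : 'rV[R]_p) : \bar R :=
  \int[mu]_(x in A) extend0 f (eucl_dist x y).

Definition polarization mu : \bar R := ereal_inf [set potential mu y | y in A].

(* A being closed, mu is supported on A iff the complement of A is null. *)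
Definition supported_on mu : Prop := mu (~` A) = 0.

(* N-point multisets are represented by N-tuples, the order of which is
   irrelevant for the counting measure; N is meant to be positive. *)
Definition counting_measure (N : nat) (w : N.-tuple 'rV[R]_p)
  : {measure set (borel_rV R p) -> \bar R} :=
  mscale (N%:R^-1 : R)%:nng%R
    (msum (fun k => dirac (nth 0%R w k : borel_rV R p)) N).

Definition discrete_polarization (N : nat) : \bar R :=
  ereal_sup [set polarization (counting_measure w) |
    w in [set w : N.-tuple 'rV[R]_p | forall i, A (tnth w i)]].

Definition attains_discrete (N : nat) nu : Prop :=
  (exists w : N.-tuple 'rV[R]_p, (forall i, A (tnth w i)) /\
     forall B : set (borel_rV R p), measurable B -> nu B = counting_measure w B)
  /\ polarization nu = discrete_polarization N.

Definition probability_on mu : Prop := mu [set: _] = 1 /\ supported_on mu.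

Definition continuous_polarization : \bar R :=
  ereal_sup [set polarization mu | mu in probability_on].

Definition solves_polarization nu : Prop :=
  probability_on nu /\ polarization nu = continuous_polarization.

Definition weak_star_cvg (mus : nat -> {measure set (borel_rV R p) -> \bar R})
    mu : Prop :=
  forall phi : 'rV[R]_p -> R, {within A, continuous phi} ->
    \int[mus n]_(x in A) (phi x)%:E @[n --> \oo] -->
    \int[mu]_(x in A) (phi x)%:E.

Definition weak_star_limit (mus : nat -> {measure set (borel_rV R p) -> \bar R})
    mu : Prop :=
  exists sub : nat -> nat, {homo sub : m n / (m < n)%N} /\
    weak_star_cvg (fun n => mus (sub n)) mu.

End polarization.

(* Main.v *)
Require Import Defs.
From mathcomp Require Import all_boot all_order all_algebra.
From mathcomp Require Import ring lra.
From mathcomp Require Import all_classical all_reals all_analysis.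
From mathcomp Require Import measurable_realfun.

Set Implicit Arguments.
Unset Strict Implicit.
Unset Printing Implicit Defensive.

Import Order.TTheory GRing.Theory Num.Theory.
Import numFieldNormedType.Exports.

Local Open Scope classical_set_scope.
Local Open Scope ring_scope.

(** Write U^mu for the potential of mu. The inequality P(nu_star) <= T holds
because nu_star is a probability measure on A (test the weak convergence
against the constant 1). The other inequality says that U^nu_star(y) >= M at
every point y of A, whenever a probability measure mu on A has P(mu) > M.

Such a mu can be discretized ([discrete_polarization_ge]): by compactness
the shifted kernel f(t + delta) still has potential > M on A for some
delta > 0. Cutting A into cells of radius < delta and concentrating the mass
of each cell, rounded down to a multiple of 1/N, at its centre makes a kernel f
of the new distances at least the shifted kernel of the old ones. Hence the
optimal N-point measures nu_N satisfy U^nu_N >= M on A for all large N.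

To pass to the limit at y although f may blow up at 0, the potential of nu_N
is not evaluated at y but at a nearby good point z, with |z - y| < r, where
the contribution of the atoms close to y is not larger than if they all were at
distance about r: if n atoms lie within 2r of y, they contribute at most
L f(r) n, with L independent of r, n and N ([exists_good_point]). The point z
is found by averaging over a maximal eta-separated set Z of points of A near y
which avoids the eta-neighbourhoods of the atoms, with eta at most of order
r n^(-1/d). Regularity of A bounds the number of points of Z in a ball of
radius rho by a constant times (rho/eta)^d, and the number of all of them from
below by a constant times (r/eta)^d. Since f(t/2) <= q f(t) for small t with
q < 2^d, summing over dyadic annuli ([dyadic_sum_le]) shows that the average
over Z of f(|x - z|) is O(f(r)) for each atom x. Only two properties of the Hausdorff
outer measure enter: finite subadditivity, and superadditivity on
sets at positive distance from each other.

Consequently M is at most the integral against nu_N of an explicit continuous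
function of |x - y|, the [majorant] at scale r: at distance t it is an upper
bound of f(t - r) if t >= 2r, and the minimum of L f(r) and f(0) if t <= 2r.
Being continuous, it can be integrated against the weak limit:
M <= \int majorant(r, |x - y|) dnu_star(x). As r -> 0 the majorant tends to
f(|x - y|) everywhere, including at x = y, and by doubling it is bounded by a
constant multiple of f(|x - y|), so dominated convergence gives
M <= U^nu_star(y).

Regularity says nothing when A is a single point; then all
probability measures on A coincide. *)

(** * The Euclidean distance and Borel sets *)

Section euclidean_distance.
Context {R : realType} {p : nat}.
Implicit Types x y z : 'rV[R]_p.

Lemma eucl_dist_ge0 x y : 0 <= eucl_dist x y.
Proof. exact: sqrtr_ge0. Qed.

Lemma eucl_distxx x : eucl_dist x x = 0.
Proof. by rewrite /eucl_dist big1 ?sqrtr0// => i _; rewrite subrr expr0n. Qed.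

Lemma eucl_distC x y : eucl_dist x y = eucl_dist y x.
Proof. by congr Num.sqrt; apply: eq_bigr => i _; rewrite -sqrrN opprB. Qed.

Lemma eucl_dist0_eq x y : eucl_dist x y = 0 -> x = y.
Proof.
move=> /eqP; rewrite sqrtr_eq0 => h; apply/rowP => i.
have h0 : \sum_(i < p) (x ord0 i - y ord0 i) ^+ 2 == 0.
  by rewrite eq_le h/=; apply: sumr_ge0 => j _; exact: sqr_ge0.
move: h0; rewrite psumr_eq0 => [/allP/(_ i)|j _]; last exact: sqr_ge0.
by rewrite mem_index_enum => /(_ isT); rewrite /= sqrf_eq0 subr_eq0 => /eqP.
Qed.

Lemma sum_sqr_eq0 (a : 'I_p -> R) :
  \sum_i a i ^+ 2 = 0 -> forall i, a i = 0.
Proof.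
move=> /eqP; rewrite psumr_eq0 => [/allP h i|j _]; last exact: sqr_ge0.
by apply/eqP; move: (h i); rewrite mem_index_enum => /(_ isT); rewrite /= sqrf_eq0.
Qed.

Lemma cauchy_schwarz_sum (a b : 'I_p -> R) :
  \sum_i a i * b i <= Num.sqrt (\sum_i a i ^+ 2) * Num.sqrt (\sum_i b i ^+ 2).
Proof.
set A := Num.sqrt (\sum_i a i ^+ 2); set B := Num.sqrt _.
have A2 : \sum_i a i ^+ 2 = A ^+ 2.
  by rewrite sqr_sqrtr//; apply: sumr_ge0 => j _; exact: sqr_ge0.
have B2 : \sum_i b i ^+ 2 = B ^+ 2.
  by rewrite sqr_sqrtr//; apply: sumr_ge0 => j _; exact: sqr_ge0.
have [A0|A0] := eqVneq A 0.
  rewrite A0 mul0r big1// => i _.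
  by rewrite (sum_sqr_eq0 _ i) ?mul0r// A2 A0 expr0n.
have [B0|B0] := eqVneq B 0.
  rewrite B0 mulr0 big1// => i _.
  by rewrite [b i](sum_sqr_eq0 _ i) ?mulr0// B2 B0 expr0n.
have Agt : 0 < A by rewrite lt_neqAle eq_sym A0 sqrtr_ge0.
have Bgt : 0 < B by rewrite lt_neqAle eq_sym B0 sqrtr_ge0.
(* multiplied by 2AB, the claim is the sum over i of (B a_i - A b_i)^2 >= 0 *)
rewrite -(ler_pM2l (mulr_gt0 (mulr_gt0 (ltr0n R 2) Agt) Bgt)) mulr_sumr.
have -> : 2 * A * B * (A * B) = \sum_i (B ^+ 2 * a i ^+ 2 + A ^+ 2 * b i ^+ 2).
  by rewrite big_split/= -!mulr_sumr A2 B2; ring.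
apply: ler_sum => i _; rewrite -subr_ge0.
have -> : B ^+ 2 * a i ^+ 2 + A ^+ 2 * b i ^+ 2 - 2 * A * B * (a i * b i) =
  (B * a i - A * b i) ^+ 2 by ring.
exact: sqr_ge0.
Qed.

Lemma eucl_dist_triangle y x z :
  eucl_dist x z <= eucl_dist x y + eucl_dist y z.
Proof.
rewrite -(@ler_pXn2r _ 2)// ?nnegrE ?addr_ge0 ?eucl_dist_ge0//.
rewrite sqrrD !sqr_sqrtr; try by apply: sumr_ge0 => j _; exact: sqr_ge0.
have -> : \sum_(i < p) (x ord0 i - z ord0 i) ^+ 2 =
  \sum_(i < p) (x ord0 i - y ord0 i) ^+ 2 +
  (\sum_(i < p) (x ord0 i - y ord0 i) * (y ord0 i - z ord0 i)) *+ 2 +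
  \sum_(i < p) (y ord0 i - z ord0 i) ^+ 2.
  by rewrite -sumrMnl -!big_split/=; apply: eq_bigr => i _; ring.
by rewrite lerD2r lerD2l lerMn2r/=; exact: cauchy_schwarz_sum.
Qed.

Lemma eucl_dist_continuous y : continuous (fun x => eucl_dist x y).
Proof.
have c (s : seq 'I_p) :
    continuous (fun x => \sum_(i <- s) (x ord0 i - y ord0 i) ^+ 2).
  elim: s => [|i s IH] x.
    by under eq_fun do rewrite big_nil; exact: cst_continuous.
  under eq_fun do rewrite big_cons.
  apply: continuousD (IH x).
  apply: (@continuous_comp _ _ _ (fun x : 'rV[R]_p => x ord0 i - y ord0 i)
    (fun t : R => t ^+ 2)); last exact: exprn_continuous.
  by apply: continuousB; [exact: coord_continuous|exact: cst_continuous].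
by move=> x; apply: (continuous_comp (c _ x)); exact: sqrt_continuous.
Qed.

End euclidean_distance.

Section borel_measurability.
Context {R : realType} {p : nat}.

Lemma open_measurable_rV (U : set 'rV[R]_p) :
  open U -> measurable (U : set (borel_rV R p)).
Proof. by move=> oU; exact: sub_sigma_algebra. Qed.

Lemma compact_measurable_rV (K : set 'rV[R]_p) :
  compact K -> measurable (K : set (borel_rV R p)).
Proof.
move=> /compact_closed; move=> /(_ (@norm_hausdorff _ _)) cK.
rewrite -[X in measurable X]setCK; apply: measurableC.
by apply: open_measurable_rV; exact: closed_openC.
Qed.

Lemma continuous_measurable_fun_rV (D : set (borel_rV R p))
  (g : 'rV[R]_p -> R) : measurable D -> continuous g ->
  measurable_fun D (g : borel_rV R p -> R).
Proof.
move=> mD /continuousP cg; apply: (measurability _ (RGenOpens.measurableE R)).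
move=> _ [_ [a [b ->] <-]]; apply: measurableI => //.
by apply: open_measurable_rV; apply: cg; exact: interval_open.
Qed.

End borel_measurability.

(** * The Hausdorff outer measure *)

Section hausdorff_outer_measure.
Context {R : realType} {p : nat}.
Implicit Types (x y z : 'rV[R]_p) (E F W : set 'rV[R]_p).
Local Open Scope ereal_scope.

Lemma eucl_diam_ge0 E : 0 <= eucl_diam E.
Proof. by rewrite le_max lexx. Qed.

Lemma eucl_diam_le E (b : \bar R) : 0 <= b ->
  (forall x y, E x -> E y -> (eucl_dist x y)%:E <= b) -> eucl_diam E <= b.
Proof.
move=> b0 h; rewrite ge_max b0/=; apply: ge_ereal_sup => _ [[x y] [/= Ex Ey] <-].
exact: h.
Qed.

Lemma eucl_dist_le_diam E x y :
  E x -> E y -> (eucl_dist x y)%:E <= eucl_diam E.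
Proof.
by move=> Ex Ey; rewrite le_max; apply/orP; right; apply: ereal_sup_ubound;
  exists (x, y).
Qed.

Lemma eucl_diamS E F : E `<=` F -> eucl_diam E <= eucl_diam F.
Proof.
move=> EF; apply: eucl_diam_le; first exact: eucl_diam_ge0.
by move=> x y /EF Fx /EF Fy; exact: eucl_dist_le_diam.
Qed.

Lemma eucl_diam_set0 : eucl_diam (set0 : set 'rV[R]_p) = 0.
Proof.
by apply/eqP; rewrite eq_le eucl_diam_ge0 andbT; exact: eucl_diam_le.
Qed.

Variable d : R.
Hypothesis d_gt0 : (0 < d)%R.

Lemma diam_powS E F : E `<=` F -> eucl_diam E `^ d <= eucl_diam F `^ d.
Proof.
move=> EF; apply: gt0_ler_poweR; rewrite ?(ltW d_gt0)//.
- by rewrite in_itv/= eucl_diam_ge0 leey.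
- by rewrite in_itv/= eucl_diam_ge0 leey.
- exact: eucl_diamS.
Qed.

Lemma hausdorff_preS (delta : R) E F : E `<=` F ->
  hausdorff_pre d delta E <= hausdorff_pre d delta F.
Proof.
move=> EF; apply: ereal_inf_le_tmp => _ [U [FU dU] <-]; exists U => //.
by split => //; exact: subset_trans FU.
Qed.

Lemma hausdorff_pre_ge0 (delta : R) E : 0 <= hausdorff_pre d delta E.
Proof.
apply: le_ereal_inf_tmp => _ [U _ <-].
by apply: nneseries_ge0 => *; exact: poweR_ge0.
Qed.

Lemma hausdorff_preU (delta : R) E F :
  hausdorff_pre d delta (E `|` F) <=
  hausdorff_pre d delta E + hausdorff_pre d delta F.
Proof.
have [->|Ey] := eqVneq (hausdorff_pre d delta E) +oo.
  by rewrite addye ?leey// gt_eqF// (lt_le_trans _ (hausdorff_pre_ge0 _ _)).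
have [->|Fy] := eqVneq (hausdorff_pre d delta F) +oo.
  by rewrite addey ?leey// gt_eqF// (lt_le_trans _ (hausdorff_pre_ge0 _ _)).
have Efin : hausdorff_pre d delta E \is a fin_num.
  by rewrite ge0_fin_numE ?hausdorff_pre_ge0// ltey.
have Ffin : hausdorff_pre d delta F \is a fin_num.
  by rewrite ge0_fin_numE ?hausdorff_pre_ge0// ltey.
apply/lee_addgt0Pr => e e0.
have [_ [U [EU dU] <-] sU] := lb_ereal_inf_adherent (divr_gt0 e0 (ltr0n R 2)) Efin.
have [_ [V [FV dV] <-] sV] := lb_ereal_inf_adherent (divr_gt0 e0 (ltr0n R 2)) Ffin.
(* the two covers are interleaved into a single sequence *)
pose W k := if odd k then V k./2 else U k./2.
have W2 n : \sum_(0 <= k < n.*2) eucl_diam (W k) `^ d =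
    \sum_(0 <= k < n) eucl_diam (U k) `^ d +
    \sum_(0 <= k < n) eucl_diam (V k) `^ d.
  elim: n => [|n IH]; first by rewrite !big_nil add0e.
  rewrite doubleS !big_nat_recr//= IH /W/= odd_double/= doubleK uphalf_double.
  by rewrite -!addeA; congr (_ + _); rewrite addeCA.
have {sU sV} : \sum_(0 <= k <oo) (eucl_diam (W k) `^ d) <=
    hausdorff_pre d delta E + hausdorff_pre d delta F + e%:E.
  apply: lime_le; first by apply: is_cvg_nneseries => *; exact: poweR_ge0.
  near=> n; apply: (@le_trans _ _ (\sum_(0 <= k < n.*2) eucl_diam (W k) `^ d)).
    have nn : (n <= n.*2)%N by rewrite -addnn leq_addr.
    rewrite (big_cat_nat (leq0n n) nn)/=.
    by rewrite leeDl// sume_ge0// => *; exact: poweR_ge0.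
  have eE : (e%:E = (e / 2)%:E + (e / 2)%:E)%E by rewrite -EFinD -splitr.
  rewrite W2 eE addeACA; apply: leeD.
    by apply: (le_trans _ (ltW sU)); apply: nneseries_lim_ge => *; exact: poweR_ge0.
  by apply: (le_trans _ (ltW sV)); apply: nneseries_lim_ge => *; exact: poweR_ge0.
apply: le_trans; apply: ereal_inf_lbound; exists W => //; split.
  move=> x [/EU [k _ Ukx]|/FV [k _ Vkx]].
    by exists k.*2 => //; rewrite /W odd_double doubleK.
  by exists k.*2.+1 => //; rewrite /W/= odd_double/= uphalf_double.
by move=> k; rewrite /W; case: ifP.
Unshelve. all: by end_near. Qed.

Lemma hausdorff_pre_le_raw (delta : R) E : (0 < delta)%R ->
  hausdorff_pre d delta E <= hausdorff_raw d E.
Proof. by move=> d0; apply: ereal_sup_ubound; exists delta. Qed.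

Lemma hausdorff_pre_anti (delta delta' : R) E : (delta <= delta')%R ->
  hausdorff_pre d delta' E <= hausdorff_pre d delta E.
Proof.
move=> dd; apply: ereal_inf_le_tmp => _ [U [EU dU] <-]; exists U => //.
by split => // k; apply: (le_trans (dU k)); rewrite lee_fin.
Qed.

Lemma hausdorff_rawS E F :
  E `<=` F -> hausdorff_raw d E <= hausdorff_raw d F.
Proof.
move=> EF; apply: ge_ereal_sup => _ [delta d0 <-].
exact: le_trans (hausdorff_preS _ EF) (hausdorff_pre_le_raw _ d0).
Qed.

Lemma hausdorff_rawU E F :
  hausdorff_raw d (E `|` F) <= hausdorff_raw d E + hausdorff_raw d F.
Proof.
apply: ge_ereal_sup => _ [delta d0 <-].
apply: (le_trans (hausdorff_preU _ _ _)).
by apply: leeD; exact: hausdorff_pre_le_raw.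
Qed.

Lemma hausdorff_raw_set0 : hausdorff_raw d (set0 : set 'rV[R]_p) = 0.
Proof.
apply/eqP; rewrite eq_le; apply/andP; split; last first.
  exact: le_trans (hausdorff_pre_ge0 1 _) (hausdorff_pre_le_raw _ ltr01).
apply: ge_ereal_sup => _ [delta d0 <-]; apply: ereal_inf_lbound.
exists (fun=> set0); last first.
  by rewrite eseries0// => *; rewrite eucl_diam_set0 poweR0r ?gt_eqF.
by split=> // k; rewrite eucl_diam_set0 lee_fin ltW.
Qed.

Lemma hausdorff_raw_cover (I : eqType) (s : seq I) (G : I -> set 'rV[R]_p) E :
  (forall x, E x -> exists2 i, i \in s & G i x) ->
  hausdorff_raw d E <= \sum_(i <- s) hausdorff_raw d (G i).
Proof.
elim: s E => [|i s IH] E h.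
  rewrite big_nil (_ : E = set0) ?hausdorff_raw_set0//.
  by rewrite -subset0 => x /h[].
rewrite big_cons; apply: (@le_trans _ _ (hausdorff_raw d (G i `|` (E `\` G i)))).
  by apply: hausdorff_rawS => x Ex; have [|] := pselect (G i x); [left|right].
apply: (le_trans (hausdorff_rawU _ _)); apply: leeD => //; apply: IH.
move=> x [/h [j]]; rewrite inE => /orP[/eqP -> //|js Gx _]; by exists j.
Qed.

(** A set of diameter at most [delta] meets at most one of the pieces, so no
covering set is counted twice. *)
Lemma hausdorff_pre_separated (I : eqType) (s : seq I) (G : I -> set 'rV[R]_p)
    (delta : R) E :
  uniq s -> (forall i, i \in s -> G i `<=` E) ->
  (forall i j x y, i \in s -> j \in s -> i != j -> G i x -> G j y ->
     (delta < eucl_dist x y)%R) ->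
  \sum_(i <- s) hausdorff_pre d delta (G i) <= hausdorff_pre d delta E.
Proof.
move=> us GE sep; apply: le_ereal_inf_tmp => _ [U [EU dU] <-].
apply: (@le_trans _ _ (\sum_(i <- s)
    \sum_(0 <= k <oo) (eucl_diam (U k `&` G i) `^ d))).
  rewrite big_seq [leRHS]big_seq; apply: lee_sum => i si.
  apply: ereal_inf_lbound; exists (fun k => U k `&` G i) => //; split.
    by move=> x Gx; have [k _ Ux] := EU _ (GE _ si _ Gx); exists k.
  by move=> k; apply: le_trans (dU k); exact: eucl_diamS.
rewrite -nneseries_sum; last by move=> *; exact: poweR_ge0.
apply: lee_nneseries => [k _ _|k _]; first by apply: sume_ge0 => *; exact: poweR_ge0.
have [[i si [x [Ux Gx]]]|none] :=
    pselect (exists2 i, i \in s & U k `&` G i !=set0); last first.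
  rewrite big_seq big1 ?poweR_ge0// => i si.
  rewrite (_ : _ `&` _ = set0) ?eucl_diam_set0 ?poweR0r ?gt_eqF//.
  by apply/eqP; apply: contrapT => /negP/set0P ne; apply: none; exists i.
rewrite (bigD1_seq i)//= big_seq_cond big1 ?adde0; first exact: diam_powS.
move=> j /andP[sj ji].
rewrite (_ : _ `&` _ = set0) ?eucl_diam_set0 ?poweR0r ?gt_eqF//.
rewrite -subset0 => y [Uy Gy].
have := eucl_dist_le_diam Uy Ux; rewrite leNgt => /negP; apply.
by apply: (le_lt_trans (dU k)); rewrite lte_fin; exact: (sep j i).
Qed.

End hausdorff_outer_measure.

(** * Separated points in a regular set *)

Definition eta_separated {R : realType} {p : nat} (eta : R) (s : seq 'rV[R]_p) :=
  uniq s /\ forall x y, x \in s -> y \in s -> x != y -> eta <= eucl_dist x y.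

(** A set of maximal cardinality is a net: a point at distance at least [eta]
from all of its elements could be added. The bound [B] provides the maximum. *)
Lemma maximal_separated {R : realType} {p : nat} (E : set 'rV[R]_p) (eta : R)
    (B : nat) :
  (forall s, eta_separated eta s -> (forall x, x \in s -> E x) -> (size s <= B)%N) ->
  exists s, [/\ eta_separated eta s, forall x, x \in s -> E x &
    forall x, E x -> exists2 z, z \in s & eucl_dist z x < eta \/ z = x].
Proof.
move=> bnd.
pose P n := `[< exists s, [/\ eta_separated eta s, forall x, x \in s -> E x &
  size s = n] >].
have P0 : exists n, P n by exists 0%N; apply/asboolP; exists [::].
have PB n : P n -> (n <= B)%N by move=> /asboolP[s [ss sE <-]]; exact: bnd.
case: (ex_maxnP P0 PB) => n /asboolP[s [[us ss] sE sn]] maxn.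
exists s; split => // x Ex.
have [[z zs h]|none] :=
  pselect (exists2 z, z \in s & eucl_dist z x < eta \/ z = x); first by exists z.
suff /maxn : P n.+1 by rewrite ltnn.
have far z : z \in s -> eta <= eucl_dist z x.
  by move=> zs; rewrite leNgt; apply/negP => zx; apply: none; exists z => //; left.
apply/asboolP; exists (x :: s); split; last by rewrite /= sn.
  split.
    by rewrite /= us andbT; apply/negP => xs; apply: none; exists x => //; right.
  move=> u v; rewrite !inE => /orP[/eqP->|us'] /orP[/eqP->|vs'] uv.
  - by rewrite eqxx in uv.
  - by rewrite eucl_distC far.
  - exact: far.
  - exact: ss.
by move=> u; rewrite inE => /orP[/eqP ->//|]; exact: sE.
Qed.

(** The normalization of the Hausdorff measure is harmless: the lower bound
of regularity forces the normalizing constant to be a positive real, and it can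
then be absorbed into [c] and [C]. *)
Lemma d_regular_hausdorff_raw {R : realType} {p : nat} (d : R)
    (A : set 'rV[R]_p) : d_regular d A -> (0 < eucl_diam A)%E ->
  exists c C r0 : R, [/\ 0 < c, 0 < C, 0 < r0 & forall y (r : R), A y -> 0 < r ->
    r <= r0 -> ((c * r `^ d)%:E <= hausdorff_raw d (eucl_ball y r `&` A) <=
                (C * r `^ d)%:E)%E].
Proof.
case=> -[y0 Ay0] _ [c [C [c0 C0 reg]]] diam0.
have [r0 r00 r0D] : exists2 r0 : R, 0 < r0 & (r0%:E < eucl_diam A)%E.
  move: diam0; case: (eucl_diam A) => [D|_|]//.
    rewrite lte_fin => D0; exists (D / 2); first exact: divr_gt0.
    by rewrite lte_fin ltr_pdivrMr// ltr_pMr// ltr1n.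
  by exists 1; [exact: ltr01|exact: ltry].
move: reg; rewrite /hausdorff; move: (hausdorff_const p d)^-1 => k reg.
have raw0 E : (0 <= hausdorff_raw d (E : set 'rV[R]_p))%E.
  apply: le_trans (hausdorff_pre_le_raw d _ ltr01); exact: hausdorff_pre_ge0.
have k0 : 0 < k.
  rewrite ltNge; apply/negP => k0.
  have /andP[+ _] := reg _ _ Ay0 r00 r0D.
  rewrite leNgt => /negP; apply.
  apply: (@le_lt_trans _ _ 0%E); first by rewrite mule_le0_ge0// lee_fin.
  by rewrite lte_fin mulr_gt0// powR_gt0.
have kV0 : 0 < k^-1 by rewrite invr_gt0.
exists (k^-1 * c), (k^-1 * C), r0; split; rewrite ?mulr_gt0//.
move=> y r Ay r_gt0 rr0.
have rD : (r%:E < eucl_diam A)%E by apply: le_lt_trans r0D; rewrite lee_fin.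
have /andP[lo hi] := reg _ _ Ay r_gt0 rD.
rewrite -(mulrA k^-1 c) -(mulrA k^-1 C) !(EFinM k^-1).
by rewrite lee_pdivlMl// lee_pdivrMl// lo hi.
Qed.

Section packing_and_covering.
Context {R : realType} {p : nat}.
Variables (d c C r0 : R) (A : set 'rV[R]_p).
Hypotheses (d_gt0 : 0 < d) (c_gt0 : 0 < c) (C_gt0 : 0 < C).
Hypothesis reg : forall y (r : R), A y -> 0 < r -> r <= r0 ->
  ((c * r `^ d)%:E <= hausdorff_raw d (eucl_ball y r `&` A) <=
   (C * r `^ d)%:E)%E.

(** The balls of radius [eta / 3] around the points of [s] are at distance at
least [eta / 3] from each other and lie in the ball of radius [2 * rho], so that
their measures add up to at most [C * (2 * rho) `^ d]. Superadditivity is used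
for [hausdorff_pre] at a small scale [delta]; choosing [delta] such that each
ball keeps half of its lower bound costs the factor 2. *)
Lemma packing_bound x (rho eta : R) s : A x -> 0 < eta -> eta <= rho ->
  2 * rho <= r0 -> eta_separated eta s ->
  (forall z, z \in s -> A z /\ eucl_dist x z < rho) ->
  (size s)%:R <= 2 * C * 6 `^ d / c * (rho `^ d / eta `^ d).
Proof.
move=> Ax eta0 eta_rho rho0 [us sep] sA.
have rho_gt0 : 0 < rho := lt_le_trans eta0 eta_rho.
have e3 : 0 < eta / 3 by rewrite divr_gt0.
pose v := c / 2 * (eta / 3) `^ d.
have v_gt0 : 0 < v by rewrite mulr_gt0 ?divr_gt0 ?powR_gt0.
pose G z := eucl_ball z (eta / 3) `&` A.
have [delta [d0 de3 dG]] : exists delta, [/\ 0 < delta, delta <= eta / 4 &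
    forall z, z \in s -> (v%:E <= hausdorff_pre d delta (G z))%E].
  have : forall z, z \in s -> A z by move=> z /sA[].
  elim: (s) => [_|z t IH zt].
    by exists (eta / 4); split => //; rewrite divr_gt0.
  (* [s] is finite and [hausdorff_pre] decreases with the scale, so one scale
     serves all points *)
  have [|delta [d0 de3 dG]] := IH; first by move=> u ut; apply: zt; rewrite inE ut orbT.
  have Az : A z by apply: zt; rewrite mem_head.
  have /andP[lo _] : ((c * (eta / 3) `^ d)%:E <= hausdorff_raw d (G z) <=
      (C * (eta / 3) `^ d)%:E)%E by apply: reg => //; lra.
  have : (v%:E < hausdorff_raw d (G z))%E.
    apply: lt_le_trans lo; rewrite lte_fin /v ltr_pM2r ?powR_gt0//.
    by rewrite ltr_pdivrMr// ltr_pMr// ltr1n.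
  case/ereal_sup_gt => _ [delta' d'0 <-] vlt.
  exists (Num.min delta delta'); split.
  - by rewrite lt_min d0 d'0.
  - by rewrite ge_min de3.
  move=> u; rewrite inE => /orP[/eqP->|ut].
    by apply: (le_trans (ltW vlt)); apply: hausdorff_pre_anti; rewrite ge_min lexx orbT.
  by apply: (le_trans (dG u ut)); apply: hausdorff_pre_anti; rewrite ge_min lexx.
have : ((size s)%:R * v <= C * (2 * rho) `^ d).
  rewrite -lee_fin.
  apply: (@le_trans _ _ (\sum_(z <- s) hausdorff_pre d delta (G z))%E).
    apply: (@le_trans _ _ (\sum_(z <- s) v%:E)%E).
      by rewrite sumEFin big_const_seq count_predT iter_addr_0 mulr_natl.
    by rewrite big_seq [leRHS]big_seq; apply: lee_sum => z; exact: dG.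
  have /andP[_ hi] : ((c * (2 * rho) `^ d)%:E <=
      hausdorff_raw d (eucl_ball x (2 * rho) `&` A) <=
      (C * (2 * rho) `^ d)%:E)%E by apply: reg => //; lra.
  apply: le_trans hi; apply: le_trans (hausdorff_pre_le_raw _ _ d0).
  apply: hausdorff_pre_separated => //.
    move=> z zs w [zw Aw]; split => //; have [_ xz] := sA z zs.
    have zw' : eucl_dist z w < eta / 3 by rewrite eucl_distC; exact: zw.
    suff : eucl_dist x w < 2 * rho by rewrite eucl_distC.
    have : eucl_dist x w <= eucl_dist x z + eucl_dist z w :=
      eucl_dist_triangle z x w.
    lra.
  move=> z w a b zs ws zw [za _] [wb _].
  have za' : eucl_dist z a < eta / 3 by rewrite eucl_distC; exact: za.
  have wb' : eucl_dist b w < eta / 3 := wb.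
  have h1 := sep _ _ zs ws zw.
  have h2 : eucl_dist z w <= eucl_dist z a + eucl_dist a w :=
    eucl_dist_triangle a z w.
  have h3 : eucl_dist a w <= eucl_dist a b + eucl_dist b w :=
    eucl_dist_triangle b a w.
  suff : delta < eucl_dist a b by [].
  lra.
have -> : (2 * rho) `^ d = 2 `^ d * rho `^ d by rewrite powRM// ltW.
have -> : v = c / 2 * (eta `^ d * 3^-1 `^ d) by rewrite /v powRM// ?invr_ge0 ?ltW.
move=> h.
have t3 : (6 : R) `^ d = 2 `^ d * 3 `^ d by rewrite -powRM//; congr (_ `^ _); lra.
have i3 : (3^-1 : R) `^ d = (3 `^ d)^-1 by rewrite -powR_inv1// -powRrM mulN1r powRN.
rewrite i3 in h; rewrite t3.
have p3 : 0 < (3 : R) `^ d by rewrite powR_gt0.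
have p2 : 0 < (2 : R) `^ d by rewrite powR_gt0.
have pe : 0 < eta `^ d by rewrite powR_gt0.
move: h.
have -> : (size s)%:R * (c / 2 * (eta `^ d / 3 `^ d)) =
  (size s)%:R * (c * eta `^ d / (2 * 3 `^ d)) by field; rewrite gt_eqF.
rewrite -ler_pdivlMr ?divr_gt0 ?mulr_gt0//.
move/le_trans; apply; rewrite le_eqVlt; apply/orP; left; apply/eqP.
by field; rewrite !gt_eqF.
Qed.

(** The measure of the ball of radius [r] is at most the sum of those of the
balls of radius [eta] which cover it. *)
Lemma covering_bound y (r eta : R) s : A y -> 0 < r -> r <= r0 -> 0 < eta ->
  eta <= r0 -> (forall z, z \in s -> A z) ->
  (forall x, A x -> eucl_dist y x < r ->
     exists2 z, z \in s & eucl_dist z x < eta) ->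
  c / C * (r `^ d / eta `^ d) <= (size s)%:R.
Proof.
move=> Ay r_gt0 rr0 eta0 etar0 sA cov.
have /andP[lo _] := reg Ay r_gt0 rr0.
have : c * r `^ d <= (size s)%:R * (C * eta `^ d).
  rewrite -lee_fin; apply: (le_trans lo).
  apply: (le_trans (@hausdorff_raw_cover _ _ _ d_gt0 _ s
    (fun z => eucl_ball z eta `&` A) _ _)).
    move=> x [xy Ax]; rewrite /eucl_ball/= eucl_distC in xy.
    have [z zs zx] := cov _ Ax xy; exists z => //; split => //.
    by rewrite /eucl_ball/= eucl_distC.
  apply: (@le_trans _ _ (\sum_(z <- s) (C * eta `^ d)%:E)%E).
    rewrite big_seq [leRHS]big_seq; apply: lee_sum => z zs.
    by have /andP[] := reg (sA _ zs) eta0 etar0.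
  by rewrite sumEFin big_const_seq count_predT iter_addr_0 mulr_natl.
rewrite -ler_pdivrMr ?mulr_gt0 ?powR_gt0//; apply: le_trans.
rewrite le_eqVlt; apply/orP; left; apply/eqP.
by field; rewrite !gt_eqF ?powR_gt0.
Qed.

End packing_and_covering.

(** * Riesz-like kernels *)

Section dyadic_sum.
Context {R : realType} {I : eqType}.
Variables (f : R -> R) (d q t0 : R).
Hypotheses (f_ge0 : forall t : R, 0 < t -> 0 <= f t)
  (f_anti : forall s t : R, 0 < s -> s <= t -> f t <= f s)
  (q_gt0 : 0 < q) (q_lt : q < 2 `^ d)
  (f_half : forall t : R, 0 < t -> t <= t0 -> f (t / 2) <= q * f t).

(** If numbers [t i] are distributed as the distances to a point in a set of
dimension [d], the sum of [f (t i)] over [t i < rho] is of the order of a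
single dyadic annulus: passing from [rho / 2] to [rho] adds at most
[K * rho `^ d * f (rho / 2)], while halving [rho] multiplies [rho `^ d * f rho]
by at most [q / 2 `^ d < 1]. The constant is the fixed point of the resulting
recurrence. *)
Lemma dyadic_sum_le (s : seq I) (t : I -> R) (K eta rho : R) :
  0 <= K -> 0 < eta -> 0 < rho -> rho <= t0 ->
  (forall i, i \in s -> eta <= t i) ->
  (forall r : R, 0 < r -> r <= rho ->
     (size [seq i <- s | t i < r])%:R <= K * r `^ d) ->
  \sum_(i <- s | t i < rho) f (t i) <=
    q * 2 `^ d / (2 `^ d - q) * (K * rho `^ d * f rho).
Proof.
move=> K0 eta0 rho0 rhot t_ge cnt.
have [n] : exists n, rho <= 2 ^+ n * eta.
  exists (Num.truncn (rho / eta)).+1; rewrite -ler_pdivrMr//.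
  apply: (le_trans (ltW (truncnS_gt _))).
  by rewrite -natrX ler_nat ltnW// ltn_expl.
set B := q * _ / _.
have Q0 : 0 < 2 `^ d - q by rewrite subr_gt0.
have p2 : 0 < (2 : R) `^ d by rewrite powR_gt0.
have B0 : 0 <= B by rewrite ltW// divr_gt0// mulr_gt0.
elim: n rho rho0 rhot cnt => [|n IH] rho rho0 rhot cnt.
  rewrite expr0 mul1r => rhoeta.
  rewrite big_seq_cond big1; last first.
    move=> i /andP[/t_ge ti]; rewrite ltNge => /negP; case.
    exact: le_trans rhoeta ti.
  by rewrite (mulr_ge0 B0)// mulr_ge0 ?mulr_ge0 ?powR_ge0 ?f_ge0.
move=> rhon.
have h0 : 0 < rho / 2 by rewrite divr_gt0.
have hle : rho / 2 <= rho by rewrite ler_pdivrMr// ler_pMr// ler1n.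
have : \sum_(i <- s | t i < rho / 2) f (t i) <=
    B * (K * (rho / 2) `^ d * f (rho / 2)).
  apply: IH => //; first exact: le_trans rhot.
    by move=> r r0 /le_trans/(_ hle); exact: cnt.
  rewrite ler_pdivrMr// (le_trans rhon)// exprS.
  by rewrite le_eqVlt; apply/orP; left; apply/eqP; ring.
have near : \sum_(i <- s | (t i < rho) && ~~ (t i < rho / 2)) f (t i) <=
    K * rho `^ d * f (rho / 2).
  apply: (@le_trans _ _ (\sum_(i <- s | t i < rho) f (rho / 2))).
    rewrite big_mkcondr/=; apply: ler_sum => i ti.
    case: ifPn => [|_]; last exact: f_ge0.
    by rewrite -leNgt => /(f_anti h0).
  rewrite -big_filter big_const_seq count_predT iter_addr_0 -[leLHS]mulr_natl.
  by apply: ler_wpM2r; [exact: f_ge0|exact: cnt].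
move=> IHr.
rewrite (bigID (fun i => t i < rho / 2))/=.
have -> : \sum_(i <- s | (t i < rho) && (t i < rho / 2)) f (t i) =
    \sum_(i <- s | t i < rho / 2) f (t i).
  apply: eq_bigl => i; apply/andP/idP => [[]//|h]; split => //.
  exact: lt_le_trans hle.
apply: (le_trans (lerD IHr near)).
have -> : (rho / 2) `^ d = rho `^ d / 2 `^ d.
  rewrite powRM ?invr_ge0 ?(ltW rho0)//; congr (_ * _).
  by rewrite -powR_inv1// -powRrM mulN1r powRN.
have -> : B * (K * (rho `^ d / 2 `^ d) * f (rho / 2)) +
    K * rho `^ d * f (rho / 2) =
    (K * rho `^ d * (B / 2 `^ d + 1)) * f (rho / 2).
  by field; rewrite gt_eqF.
have -> : B * (K * rho `^ d * f rho) = K * rho `^ d * (B / 2 `^ d + 1) * (q * f rho).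
  by rewrite /B; field; rewrite !gt_eqF.
apply: ler_wpM2l; last exact: f_half.
by rewrite !mulr_ge0 ?powR_ge0// addr_ge0// divr_ge0// ltW.
Qed.

End dyadic_sum.

Section riesz_like_functions.
Context {R : realType}.
Variables (d : R) (f : R -> R).
Hypothesis f_riesz : riesz_like d f.

Lemma riesz_like_gt0 t : 0 < t -> 0 < f t.
Proof. by case: f_riesz => + _ _ _; apply. Qed.

Lemma riesz_like_anti s t : 0 < s -> s <= t -> f t <= f s.
Proof.
move=> s0; rewrite le_eqVlt => /predU1P[->//|st].
by case: f_riesz => _ _ + _ => /(_ s t s0 st)/ltW.
Qed.

Lemma riesz_like_continuous (t : R) : 0 < t -> {for t, continuous f}.
Proof. by case: f_riesz => _ + _ _ t0; apply; rewrite in_itv/= t0. Qed.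

(** With [q = 2 `^ (d - eps)], this is the monotonicity of
[t `^ (d - eps) * f t] between [t / 2] and [t]. *)
Lemma riesz_like_half : exists q t0 : R, [/\ 0 < q, q < 2 `^ d, 0 < t0 &
  forall t, 0 < t -> t <= t0 -> f (t / 2) <= q * f t].
Proof.
case: f_riesz => fpos _ _ [eps [te [/andP[eps0 epsd] te0 /= mono]]].
exists (2 `^ (d - eps)), te; split => //.
  have -> : 2 `^ d = 2 `^ (d - eps) * 2 `^ eps :> R.
    by rewrite -powRD ?subrK// pnatr_eq0 implybT.
  rewrite ltr_pMr ?powR_gt0//.
  have := @gt0_ltr_powR R eps eps0 1 2; rewrite powR1; apply.
  - by rewrite nnegrE.
  - by rewrite nnegrE.
  - by rewrite ltr1n.
move=> t t_gt0 tte.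
have h0 : 0 < t / 2 by rewrite divr_gt0.
have := mono (t / 2) t (ltW h0) _ tte.
rewrite !gt_eqF// => /(_ _)/wrap[|]; first lra.
rewrite powRM ?invr_ge0 ?(ltW t_gt0)//.
have -> : 2^-1 `^ (d - eps) = (2 `^ (d - eps))^-1 :> R.
  by rewrite -powR_inv1// -powRrM mulN1r powRN.
rewrite -mulrA ler_pM2l ?powR_gt0// ler_pdivrMl ?powR_gt0//.
Qed.

(** Beyond the range of [riesz_like_half] the kernel is bounded above and
below on bounded intervals. *)
Lemma riesz_like_doubling (D : R) : 0 < D ->
  exists2 C0 : R, 1 <= C0 & forall t, 0 < t -> t <= D -> f (t / 2) <= C0 * f t.
Proof.
move=> D0; have [q [t0 [q0 _ t00 half]]] := riesz_like_half.
have fD := riesz_like_gt0 D0.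
pose C0 := Num.max (Num.max 1 q) (f (t0 / 2) / f D).
exists C0; first by rewrite !le_max lexx.
move=> t t_gt0 tD; have ft := riesz_like_gt0 t_gt0.
have [tt|/ltW tt] := leP t t0.
  by apply: (le_trans (half _ t_gt0 tt)); rewrite ler_pM2r// !le_max lexx orbT.
apply: (@le_trans _ _ (f (t0 / 2))).
  by apply: riesz_like_anti; rewrite ?divr_gt0// ler_pM2r.
apply: (@le_trans _ _ (f (t0 / 2) / f D * f t)).
  rewrite mulrAC ler_pdivlMr// ler_pM2l ?riesz_like_gt0 ?divr_gt0//.
  exact: riesz_like_anti.
by rewrite ler_pM2r// le_max lexx orbT.
Qed.

Lemma extend0_gt0E t : 0 < t -> extend0 f t = (f t)%:E.
Proof. by move=> t0; rewrite /extend0 gt_eqF. Qed.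

Lemma extend0_cvg : (f s)%:E @[s --> 0^'+] --> extend0 f 0.
Proof.
rewrite /extend0 eqxx.
have := @nonincreasing_at_right_cvge R (EFin \o f) 0 (BInfty _ false) isT.
move=> /(_ _)/wrap[|h]; last by rewrite (cvg_lim _ h).
move=> s t; rewrite !in_itv/= !andbT => s0 t0 st.
by rewrite lee_fin riesz_like_anti.
Qed.

Lemma le_extend0_0 t : 0 < t -> ((f t)%:E <= extend0 f 0)%E.
Proof.
move=> t0; apply: (cvge_to_ge extend0_cvg).
near=> s; rewrite lee_fin; apply: riesz_like_anti; near: s.
  exact: nbhs_right_gt.
exact: nbhs_right_le.
Unshelve. all: by end_near. Qed.

Lemma extend0_anti s t : 0 <= s -> s <= t -> (extend0 f t <= extend0 f s)%E.
Proof.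
move=> s0 st; have [s0'|s1] := eqVneq s 0.
  subst s; have [->//|t1] := eqVneq t 0.
  by rewrite extend0_gt0E ?le_extend0_0// lt_neqAle eq_sym t1.
have {s0 s1} s0 : 0 < s by rewrite lt_neqAle eq_sym s1.
rewrite !extend0_gt0E// ?lee_fin; last exact: lt_le_trans st.
exact: riesz_like_anti.
Qed.

Lemma extend0_ge0 t : 0 <= t -> (0 <= extend0 f t)%E.
Proof.
move=> t0; apply: le_trans (extend0_anti t0 (_ : t <= t + 1)).
  by rewrite extend0_gt0E ?lee_fin ?ltW ?riesz_like_gt0// ltr_wpDl.
by rewrite lerDl.
Qed.

Lemma extend0_cvg_seq (u : nat -> R) (t : R) : 0 <= t -> (forall n, 0 < u n) ->
  u n @[n --> \oo] --> t -> (f (u n))%:E @[n --> \oo] --> extend0 f t.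
Proof.
move=> t0 u0 ut; have [t1|t1] := eqVneq t 0.
  subst t; apply: cvg_comp extend0_cvg.
  move=> P PN; have : \forall n \near \oo, 0 < u n -> P (u n) := ut _ PN.
  by apply: filterS => n; apply.
have {}t0 : 0 < t by rewrite lt_neqAle eq_sym t1.
rewrite extend0_gt0E//; apply: cvg_EFin; first by apply: nearW.
by apply: (cvg_comp _ _ ut); exact: riesz_like_continuous.
Qed.

Lemma extend0_shift_cvg (t : R) : 0 <= t ->
  (f (t + n.+1%:R^-1))%:E @[n --> \oo] --> extend0 f t.
Proof.
move=> t0; apply: extend0_cvg_seq => //.
  by move=> n; rewrite ltr_wpDl// invr_gt0.
by rewrite -[X in _ --> X]addr0; apply: cvgD; [exact: cvg_cst|exact: cvg_harmonic].
Qed.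

Section kernel_measurability.
Context {p : nat}.
Implicit Types x y : 'rV[R]_p.

Lemma comp_eucl_dist_continuous (g : R -> R) y :
  (forall t : R, 0 <= t -> {for t, continuous g}) ->
  continuous (fun x => g (eucl_dist x y)).
Proof.
move=> cg x; apply: (continuous_comp (@eucl_dist_continuous _ _ y x)).
exact: (cg _ (eucl_dist_ge0 _ _)).
Qed.

Lemma riesz_like_comp_continuous (g : R -> R) (t : R) :
  {for t, continuous g} -> 0 < g t -> {for t, continuous (f \o g)}.
Proof.
by move=> cg gt; apply: continuous_comp => //; exact: riesz_like_continuous.
Qed.

Lemma measurable_shifted_kernel (D : set (borel_rV R p)) (delta : R) y :
  measurable D -> 0 < delta ->
  measurable_fun D (fun x : borel_rV R p => (f (eucl_dist x y + delta))%:E).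
Proof.
move=> mD d0; apply/measurable_EFinP.
apply: (continuous_measurable_fun_rV mD
  (@comp_eucl_dist_continuous (fun t => f (t + delta)) y _)) => t t0.
apply: (@riesz_like_comp_continuous (fun t => t + delta)).
  by apply: continuousD; [exact: cvg_id|exact: cst_continuous].
by rewrite ltr_wpDl.
Qed.

Lemma measurable_riesz_kernel (D : set (borel_rV R p)) y : measurable D ->
  measurable_fun D (fun x : borel_rV R p => extend0 f (eucl_dist x y)).
Proof.
move=> mD; apply: (emeasurable_fun_cvg
  (fun n (x : borel_rV R p) => (f (eucl_dist x y + n.+1%:R^-1))%:E)).
  by move=> n; apply: measurable_shifted_kernel; rewrite ?invr_gt0.
by move=> x _; apply: extend0_shift_cvg; exact: eucl_dist_ge0.
Qed.

End kernel_measurability.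

End riesz_like_functions.

(** * Points of small potential *)

Lemma exists_le_average {R : realType} {I : eqType} (s : seq I) (S : I -> R) :
  (0 < size s)%N ->
  exists2 z, z \in s & S z * (size s)%:R <= \sum_(w <- s) S w.
Proof.
move=> s0; have [z zs zmin] : exists2 z, z \in s & forall w, w \in s -> S z <= S w.
  elim: s s0 => // a [|b s] IH _.
    by exists a; rewrite ?mem_head// => w; rewrite inE => /eqP->.
  have [//|z zs zmin] := IH.
  have [az|/ltW za] := leP (S a) (S z).
    exists a; rewrite ?mem_head// => w; rewrite inE => /orP[/eqP->//|/zmin].
    exact: le_trans.
  exists z; first by rewrite inE zs orbT.
  by move=> w; rewrite inE => /orP[/eqP->//|/zmin].
exists z => //; rewrite mulr_natr -iter_addr_0 -(count_predT s) -big_const_seq.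
by rewrite big_seq [leRHS]big_seq; exact: ler_sum.
Qed.

Section good_point.
Context {R : realType} {p : nat}.
Variables (d : R) (A : set 'rV[R]_p) (f : R -> R).
Hypotheses (d_gt0 : 0 < d) (A_regular : d_regular d A)
  (A_diam : (0 < eucl_diam A)%E) (f_riesz : riesz_like d f).

(** Potential theory would use that the normalized Hausdorff measure on a
ball has a potential which is [O(f r)] there. A maximal [eta]-separated set [Z]
replaces this measure, and the averaged potential is compared with the [size xs]
atoms. Excluding from [Z] the points at distance less than [eta] from an atom
makes all values of [f] finite; the excluded points are covered by [size xs]
balls of radius [eta], a negligible part once [eta] is small. *)
Lemma exists_good_point : exists L r1 : R, [/\ 0 < L, 0 < r1 &
  forall (y : 'rV[R]_p) (r : R) (xs : seq 'rV[R]_p), A y -> 0 < r -> r <= r1 ->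
  (forall x, x \in xs -> A x /\ eucl_dist x y < 2 * r) ->
  exists z, [/\ A z, eucl_dist z y < r,
    forall x, x \in xs -> 0 < eucl_dist x z &
    \sum_(x <- xs) f (eucl_dist x z) <= L * f r * (size xs)%:R]].
Proof.
have [c [C [r0 [c0 C0 r00 reg]]]] := d_regular_hausdorff_raw A_regular A_diam.
have [q [t0 [q0 qlt t00 half]]] := riesz_like_half f_riesz.
have f_ge0 t : 0 < t -> 0 <= f t by move=> ?; exact/ltW/(riesz_like_gt0 f_riesz).
have f_anti := riesz_like_anti f_riesz.
have [k kE] : exists k, k = c / C by eexists.
have [K KE] : exists K, K = 2 * C * 6 `^ d / c by eexists.
have [B BE] : exists B, B = q * 2 `^ d / (2 `^ d - q) by eexists.
have k0 : 0 < k by rewrite kE divr_gt0.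
have K0 : 0 < K by rewrite KE divr_gt0// !mulr_gt0 ?powR_gt0.
have B0 : 0 < B by rewrite BE divr_gt0 ?subr_gt0// mulr_gt0 ?powR_gt0.
exists (2 * B * K * 3 `^ d / k), (Num.min (r0 / 6) (t0 / 3)); split.
- by rewrite divr_gt0// !mulr_gt0 ?powR_gt0.
- by rewrite lt_min !divr_gt0.
move=> y r xs Ay r_gt0; rewrite le_min => /andP[rr0 rt0] xsA.
pose n := size xs.
(* [X] is the value of (r / eta)^d; it makes the packing large compared with
   the number of atoms: k X >= 2 n *)
have [X XE] : exists X, X = 1 + 2 * n%:R / k by eexists.
have n0 : 0 <= n%:R :> R by exact: ler0n.
have X1 : 1 <= X by rewrite XE lerDl divr_ge0 ?mulr_ge0 // ?(ltW k0).
have X0 : 0 < X by rewrite (lt_le_trans _ X1).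
have kX : k * X = k + 2 * n%:R by rewrite XE; field; rewrite gt_eqF.

have Xd : 1 <= X `^ d^-1.
  rewrite -[leLHS]/((fun=> 1) d^-1) -powR1 ge0_ler_powR// ?invr_ge0 ?(ltW d_gt0)//.
  - by rewrite nnegrE.
  - by rewrite nnegrE ltW.
have [eta etaE] : exists eta, eta = r / X `^ (d^-1) by eexists.
have eta0 : 0 < eta by rewrite etaE divr_gt0// powR_gt0.
have eta_r : eta <= r.
  rewrite etaE ler_pdivrMr ?powR_gt0//.
  by rewrite ler_pMr.
have pe0 : 0 < eta `^ d by exact: powR_gt0.
have pr0 : 0 < r `^ d by exact: powR_gt0.
have reX : r `^ d / eta `^ d = X.
  have -> : r = eta * X `^ d^-1 by rewrite etaE mulfVK// gt_eqF// powR_gt0.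
  rewrite powRM ?powR_ge0 ?(ltW eta0)// -powRrM mulVf ?gt_eqF// powRr1 ?ltW//.
  by rewrite mulrAC mulfV ?mul1r// gt_eqF.
pose E : set 'rV[R]_p := [set z | [/\ A z, eucl_dist y z < r &
  forall x, x \in xs -> eta <= eucl_dist x z]].
have r6 : 6 * r <= r0 by lra.
have [s sep sE|Z [[Zu Zsep] ZE Zmax]] :=
    @maximal_separated _ _ E eta (Num.truncn (K * X)).+1.
  rewrite -(ler_nat R); apply: (@le_trans _ _ (K * X)); last first.
    exact/ltW/truncnS_gt.
  rewrite -reX KE; apply: (packing_bound d_gt0 c0 reg Ay eta0 eta_r _ sep).
    lra.
  by move=> z /sE[].
(* [Z] and [xs] together form an [eta]-net of the ball *)
have Zbig : k * X <= 2 * (size Z)%:R.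
  have : k * X <= (size (Z ++ xs))%:R.
    rewrite -reX kE; apply: (covering_bound d_gt0 C0 reg Ay) => //; first lra.
    - lra.
    - by move=> z; rewrite mem_cat => /orP[/ZE[]//|/xsA[]].
    move=> x Ax yx.
    have [Ex|nEx] := pselect (E x).
      have [z zZ h] := Zmax _ Ex; exists z; first by rewrite mem_cat zZ.
      by case: h => [//|->]; rewrite eucl_distxx.
    have [[w wxs wx]|none] :=
        pselect (exists2 w, w \in xs & eucl_dist w x < eta).
      by exists w => //; rewrite mem_cat wxs orbT.
    case: nEx; split => // w wxs; rewrite leNgt; apply/negP => wx.
    by apply: none; exists w.
  rewrite size_cat natrD -/n kX; lra.
have Z0 : (0 < size Z)%N.
  by rewrite -(ltr0n R); have := mulr_gt0 k0 X0; lra.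
have xsum x : x \in xs -> \sum_(z <- Z) f (eucl_dist x z) <=
    B * K * 3 `^ d * X * f r.
  move=> xxs; have [Ax xy] := xsA _ xxs.
  have near3 z : z \in Z -> eucl_dist x z < 3 * r.
    move=> /ZE[_ yz _]; have : eucl_dist x z <= eucl_dist x y + eucl_dist y z :=
      eucl_dist_triangle y x z; lra.
  have -> : \sum_(z <- Z) f (eucl_dist x z) =
      \sum_(z <- Z | eucl_dist x z < 3 * r) f (eucl_dist x z).
    rewrite big_seq [RHS]big_seq_cond; apply: eq_bigl => z.
    by have [zZ|//] := boolP (z \in Z); rewrite near3.
  have r3 : 0 < 3 * r by rewrite mulr_gt0.
  apply: (le_trans (@dyadic_sum_le _ _ f d q t0 f_ge0 f_anti q0 qlt half Z
    (eucl_dist x) (K / eta `^ d) eta (3 * r) _ eta0 r3 _ _ _)).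
  - by rewrite divr_ge0 ?ltW.
  - lra.
  - by move=> z /ZE[_ _]; apply.
  - move=> rho rho0 rhor; have [re|er] := leP rho eta.
      rewrite (_ : [seq _ <- _ | _] = [::]).
        by rewrite mulr_ge0 ?powR_ge0// divr_ge0 ?ltW.
      apply/eqP; rewrite -[_ == _]negbK -has_filter.
      apply/negP => /hasP[z /ZE[_ _ h] zr].
      by have := h _ xxs; rewrite leNgt (lt_le_trans zr).
    have -> : K / eta `^ d * rho `^ d = K * (rho `^ d / eta `^ d) by ring.
    rewrite KE; apply: (packing_bound d_gt0 c0 reg Ax eta0 (ltW er)); first lra.
      split; first exact: filter_uniq.
      move=> u v; rewrite !mem_filter => /andP[_ uZ] /andP[_ vZ]; exact: Zsep.
    by move=> z; rewrite mem_filter => /andP[xz /ZE[]].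
  have -> : (3 * r) `^ d = 3 `^ d * r `^ d by rewrite powRM// ltW.
  rewrite -BE -reX.
  have -> : B * (K / eta `^ d * (3 `^ d * r `^ d) * f (3 * r)) =
     B * K * 3 `^ d * (r `^ d / eta `^ d) * f (3 * r) by ring.
  apply: ler_wpM2l; last by apply: f_anti => //; lra.
  by rewrite !mulr_ge0 ?powR_ge0 ?invr_ge0 ?ltW.
have [z zZ zavg] := @exists_le_average R _ Z
  (fun z => \sum_(x <- xs) f (eucl_dist x z)) Z0.
have [Az yz zxs] := ZE _ zZ.
exists z; split => //; first by rewrite eucl_distC.
  by move=> x xxs; exact: lt_le_trans eta0 (zxs _ xxs).
have total : \sum_(w <- Z) \sum_(x <- xs) f (eucl_dist x w) <=
    n%:R * (B * K * 3 `^ d * X * f r).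
  rewrite exchange_big/= [leRHS]mulr_natl /n -iter_addr_0.
  rewrite -(count_predT xs) -big_const_seq.
  by rewrite big_seq [leRHS]big_seq; exact: ler_sum.
have {zavg total} := le_trans zavg total.
have sZ : 0 < (size Z)%:R :> R by rewrite ltr0n.
rewrite -ler_pdivlMr// => /le_trans; apply.
rewrite ler_pdivrMr// -/n.
have -> : 2 * B * K * 3 `^ d / k * f r * n%:R * (size Z)%:R =
  n%:R * (B * K * 3 `^ d * (2 * (size Z)%:R / k) * f r).
  by field; rewrite gt_eqF.
apply: ler_wpM2l => //; apply: ler_wpM2r; first exact: f_ge0.
apply: ler_wpM2l; first by rewrite !mulr_ge0 ?powR_ge0 ?ltW.
by rewrite ler_pdivlMr// mulrC.
Qed.

End good_point.

(** * A continuous majorant of the kernel *)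

Lemma cvg_maxr {R : realType} {T : Type} (F : set_system T) {FF : Filter F}
    (g h : T -> R) (a b : R) : g x @[x --> F] --> a -> h x @[x --> F] --> b ->
  Num.max (g x) (h x) @[x --> F] --> Num.max a b.
Proof.
move=> ga hb; under eq_fun do rewrite maxr_absE; rewrite maxr_absE.
apply: cvgM; [|exact: cvg_cst]; apply: cvgD; first exact: cvgD.
by apply: cvg_norm; apply: cvgB.
Qed.

Lemma cvg_minr {R : realType} {T : Type} (F : set_system T) {FF : Filter F}
    (g h : T -> R) (a b : R) : g x @[x --> F] --> a -> h x @[x --> F] --> b ->
  Num.min (g x) (h x) @[x --> F] --> Num.min a b.
Proof.
move=> ga hb; under eq_fun do rewrite minr_absE; rewrite minr_absE.
apply: cvgM; [|exact: cvg_cst]; apply: cvgB; first exact: cvgD.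
by apply: cvg_norm; apply: cvgB.
Qed.

Section kernel_majorant.
Context {R : realType}.
Variables (d : R) (f : R -> R) (L : R).
Hypotheses (f_riesz : riesz_like d f) (L_ge1 : 1 <= L).

(** The value of the majorant within [2 * r] of the origin. The minimum with
f(0) makes it tend to f(0) as [r] tends to 0, also when f(0) is finite and
[L > 1]. *)
Definition near_bound (r : R) : R := fine (mine (L * f r)%:E (extend0 f 0)).

Definition cutoff (r t : R) : R := Num.max 0 (Num.min 1 (3 - t / r)).

(** An upper bound for the contribution of an atom at distance [t] from [y] to
the potential at a good point within [r] of [y]: for each atom with
[t >= 2 * r], and on average over the other ones. The cutoff makes the transition
continuous. *)
Definition majorant (r t : R) : R :=
  f (Num.max (t - r) r) + (near_bound r - f r) * cutoff r t.

Lemma near_boundE r : 0 < r ->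
  (near_bound r)%:E = mine (L * f r)%:E (extend0 f 0).
Proof.
move=> r0; rewrite fineK//.
have h : ((f r)%:E <= mine (L * f r)%:E (extend0 f 0))%E.
  rewrite le_min (le_extend0_0 f_riesz r0) andbT lee_fin ler_peMl//.
  exact/ltW/(riesz_like_gt0 f_riesz).
rewrite fin_numElt (lt_le_trans _ h) ?ltNyr//=.
by apply: (@le_lt_trans _ _ (L * f r)%:E); rewrite ?ltry// ge_min lexx.
Qed.

Lemma near_bound_ge r : 0 < r -> f r <= near_bound r.
Proof.
move=> r0; rewrite -lee_fin near_boundE// le_min (le_extend0_0 f_riesz r0) andbT.
by rewrite lee_fin ler_peMl//; exact/ltW/(riesz_like_gt0 f_riesz).
Qed.

Lemma near_bound_le_extend0 r : 0 < r -> ((near_bound r)%:E <= extend0 f 0)%E.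
Proof. by move=> r0; rewrite near_boundE// ge_min lexx orbT. Qed.

Lemma near_bound_le r : 0 < r -> near_bound r <= L * f r.
Proof. by move=> r0; rewrite -lee_fin near_boundE// ge_min lexx. Qed.

Lemma cutoff_ge0 r t : 0 <= cutoff r t.
Proof. by rewrite le_max lexx. Qed.

Lemma cutoff_le1 r t : cutoff r t <= 1.
Proof. by rewrite ge_max ler01 ge_min lexx. Qed.

Lemma cutoff_near r t : 0 < r -> t <= 2 * r -> cutoff r t = 1.
Proof.
move=> r0 t2; rewrite /cutoff.
have tr : t / r <= 2 by rewrite ler_pdivrMr.
by rewrite (min_idPl _) ?(max_idPr _)//; lra.
Qed.

Lemma cutoff_far r t : 0 < r -> 3 * r <= t -> cutoff r t = 0.
Proof.
move=> r0 t3; rewrite /cutoff.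
have tr : 3 <= t / r by rewrite ler_pdivlMr.
by rewrite (max_idPl _)// ge_min; apply/orP; right; lra.
Qed.

Lemma majorant_ge0 r t : 0 < r -> 0 <= majorant r t.
Proof.
move=> r0; rewrite addr_ge0//.
  by apply/ltW/(riesz_like_gt0 f_riesz); rewrite lt_max r0 orbT.
by rewrite mulr_ge0 ?cutoff_ge0// subr_ge0 near_bound_ge.
Qed.

Lemma majorant_near r t : 0 < r -> t <= 2 * r -> majorant r t = near_bound r.
Proof.
move=> r0 t2; rewrite /majorant cutoff_near// mulr1 (max_idPr _); last by lra.
by rewrite addrCA subrr addr0.
Qed.

Lemma majorant_far r t : 0 < r -> 2 * r <= t -> f (t - r) <= majorant r t.
Proof.
move=> r0 t2; rewrite /majorant (max_idPl _); last by lra.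
by rewrite lerDl mulr_ge0 ?cutoff_ge0// subr_ge0 near_bound_ge.
Qed.

Lemma majorant_continuous r : 0 < r -> continuous (majorant r).
Proof.
move=> r0 t; apply: cvgD.
  apply: (@riesz_like_comp_continuous _ _ _ f_riesz
    (fun t => Num.max (t - r) r)); last by rewrite lt_max r0 orbT.
  by apply: cvg_maxr; [apply: cvgB; [exact: cvg_id|exact: cvg_cst]|exact: cvg_cst].
apply: cvgM; first exact: cvg_cst.
apply: cvg_maxr; first exact: cvg_cst.
apply: cvg_minr; first exact: cvg_cst.
apply: cvgB; first exact: cvg_cst.
by apply: cvgM; [exact: cvg_id|exact: cvg_cst].
Qed.

(** By doubling: [Num.max (t - r) r >= t / 2], and where the cutoff does not
vanish, [r >= t / 4]. At [t = 0] the bound is [near_bound_le_extend0]. *)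
Lemma majorant_le_kernel (D : R) : 0 < D -> exists2 C : R, 0 <= C &
  forall r t, 0 < r -> 0 <= t -> t <= D ->
    ((majorant r t)%:E <= C%:E * extend0 f t)%E.
Proof.
move=> D0; have [C0 C01 dbl] := riesz_like_doubling f_riesz D0.
have C0_ge0 : 0 <= C0 := le_trans ler01 C01.
have L0 : 0 <= L := le_trans ler01 L_ge1.
exists (C0 + L * C0 ^+ 2); first by rewrite addr_ge0// mulr_ge0// sqr_ge0.
move=> r t r0; rewrite le_eqVlt => /predU1P[<- _|t0 tD].
  rewrite majorant_near//; last by rewrite mulr_ge0// ltW.
  apply: (le_trans (near_bound_le_extend0 r0)).
  rewrite -[leLHS]mul1e; apply: lee_wpmul2r; first exact: (extend0_ge0 f_riesz).
  by rewrite lee_fin (le_trans C01)// lerDl mulr_ge0// sqr_ge0.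
rewrite extend0_gt0E// -EFinM lee_fin mulrDl.
have anti := riesz_like_anti f_riesz.
have fr := riesz_like_gt0 f_riesz r0.
apply: lerD.
  apply: le_trans (dbl _ t0 tD); apply: anti; first by rewrite divr_gt0.
  by rewrite le_max; apply/orP; have [tr|rt] := leP t (2 * r); [right|left]; lra.
have ft := riesz_like_gt0 f_riesz t0.
have [far|near] := leP (3 * r) t.
  by rewrite cutoff_far// mulr0 mulr_ge0 ?(ltW ft)// mulr_ge0// sqr_ge0.
apply: (@le_trans _ _ (L * f r)).
  apply: (@le_trans _ _ (near_bound r - f r)).
    by rewrite ler_piMr ?cutoff_le1// subr_ge0 near_bound_ge.
  have := near_bound_le r0; lra.
rewrite -mulrA; apply: ler_wpM2l => //.
have t2 : 0 < t / 2 by rewrite divr_gt0.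
apply: (@le_trans _ _ (f (t / 2 / 2))); first by apply: anti; lra.
apply: (le_trans (dbl _ t2 _)); first by lra.
by rewrite expr2 -mulrA; apply: ler_wpM2l => //; exact: dbl.
Qed.

(** For [t = 0] the value is squeezed between [f (r n)] and f(0); this is the
point where the minimum in [near_bound] is needed. *)
Lemma majorant_cvg (r : nat -> R) (t : R) : (forall n, 0 < r n) ->
  r n @[n --> \oo] --> 0 -> 0 <= t ->
  (majorant (r n) t)%:E @[n --> \oo] --> extend0 f t.
Proof.
move=> r0 rc; rewrite le_eqVlt => /predU1P[<-|t0].
  apply: (squeeze_cvge _ (extend0_cvg_seq f_riesz (lexx 0) r0 rc) (cvg_cst _)).
  near=> n; rewrite majorant_near// ?mulr_ge0 ?(ltW (r0 _))//.
  by rewrite lee_fin near_bound_ge//= near_bound_le_extend0.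
have uc : Num.max (t - r n) (r n) @[n --> \oo] --> t.
  rewrite [X in _ --> X](_ : t = Num.max (t - 0) 0); last first.
    by rewrite subr0 (max_idPl _)// ltW.
  by apply: cvg_maxr => //; apply: cvgB => //; exact: cvg_cst.
apply: cvg_trans (extend0_cvg_seq f_riesz (ltW t0) _ uc); last first.
  by move=> n; rewrite lt_max r0 orbT.
apply: near_eq_cvg; near=> n; rewrite /majorant cutoff_far ?mulr0 ?addr0//.
rewrite -ler_pdivlMl//; near: n.
by apply: (cvgr_le _ rc); rewrite mulr_gt0 ?invr_gt0.
Unshelve. all: by end_near. Qed.

End kernel_majorant.

(** * Potentials of counting measures *)

Section counting_measures.
Context {R : realType} {p : nat}.
Variables (A : set 'rV[R]_p).
Hypothesis A_compact : compact A.

Lemma integral_counting_measure N (w : N.-tuple 'rV[R]_p)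
    (g : borel_rV R p -> \bar R) : measurable_fun (A : set (borel_rV R p)) g ->
  (forall x, A x -> 0 <= g x)%E -> (forall x, x \in (w : seq _) -> A x) ->
  (\int[counting_measure w]_(x in A) g x = (N%:R^-1)%:E * \sum_(x <- w) g x)%E.
Proof.
move=> mg g0 wA; have mA := compact_measurable_rV A_compact.
rewrite ge0_integral_mscale//=; congr (_ * _)%E.
rewrite ge0_integral_measure_sum// (big_nth 0%R) size_tuple big_mkord.
apply: eq_bigr => k _; rewrite integral_dirac// diracE mem_set ?mul1e//.
by apply: wA; apply: mem_nth; rewrite size_tuple.
Qed.

End counting_measures.

Section discrete_potentials.
Context {R : realType} {p : nat}.
Variables (d : R) (A : set 'rV[R]_p) (f : R -> R).
Hypotheses (A_compact : compact A) (f_riesz : riesz_like d f).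

Lemma potential_counting_measure N (w : N.-tuple 'rV[R]_p) y :
  (forall x, x \in (w : seq _) -> A x) ->
  (potential A f (counting_measure w) y =
   (N%:R^-1)%:E * \sum_(x <- w) extend0 f (eucl_dist x y))%E.
Proof.
move=> wA; apply: integral_counting_measure => //.
  by apply: (measurable_riesz_kernel f_riesz); exact: compact_measurable_rV.
by move=> x _; apply: (extend0_ge0 f_riesz); exact: eucl_dist_ge0.
Qed.

Lemma majorant_dist_continuous (L r : R) (y : 'rV[R]_p) : 0 < r ->
  continuous (fun x => majorant f L r (eucl_dist x y)).
Proof.
move=> r0; apply: comp_eucl_dist_continuous => t _.
exact: (majorant_continuous f_riesz).
Qed.

Lemma measurable_majorant (L r : R) (y : 'rV[R]_p) : 0 < r ->
  measurable_fun (A : set (borel_rV R p))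
    (fun x : borel_rV R p => (majorant f L r (eucl_dist x y))%:E).
Proof.
move=> r0; apply/measurable_EFinP.
apply: (continuous_measurable_fun_rV (compact_measurable_rV A_compact)).
exact: majorant_dist_continuous.
Qed.

Lemma near_sum_le_bound (L r S : R) (n : nat) : 0 < r -> 1 <= L ->
  S <= L * f r * n%:R -> (S%:E <= extend0 f 0 * (n%:R)%:E)%E ->
  S <= near_bound f L r * n%:R.
Proof.
move=> r0 L1 S1 S2; rewrite -lee_fin EFinM (near_boundE f_riesz)// /mine.
by case: ifP => _.
Qed.

(** The polarization is at most the potential at the good point [z] for the
atoms within [2 * r] of [y]. Those atoms contribute what the majorant allows on
average, and each of the others is at distance at least [eucl_dist x y - r]
from [z]. *)
Lemma polarization_le_integral_majorant (L r1 : R) N (w : N.-tuple 'rV[R]_p)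
    (y : 'rV[R]_p) (r : R) (M : \bar R) : 1 <= L ->
  (forall (r : R) (xs : seq 'rV[R]_p), 0 < r -> r <= r1 ->
    (forall x, x \in xs -> A x /\ eucl_dist x y < 2 * r) ->
    exists z, [/\ A z, eucl_dist z y < r,
      forall x, x \in xs -> 0 < eucl_dist x z &
      \sum_(x <- xs) f (eucl_dist x z) <= L * f r * (size xs)%:R]) ->
  (forall x, x \in (w : seq _) -> A x) -> 0 < r -> r <= r1 ->
  (M <= polarization A f (counting_measure w))%E ->
  (M <= \int[counting_measure w]_(x in A) (majorant f L r (eucl_dist x y))%:E)%E.
Proof.
move=> L1 good wA r0 rr1 /le_trans; apply.
pose xs := [seq x <- w | eucl_dist x y < 2 * r].
have [x|z [Az zy xz Sle]] := good r xs r0 rr1.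
  by rewrite mem_filter => /andP[xy /wA].
apply: (@le_trans _ _ (potential A f (counting_measure w) z)).
  by apply: ereal_inf_lbound; exists z.
rewrite potential_counting_measure// integral_counting_measure//; last 2 first.
  exact: measurable_majorant.
  by move=> x _; rewrite lee_fin (majorant_ge0 f_riesz).
apply: lee_wpmul2l; first by rewrite lee_fin invr_ge0.
have far x : x \in (w : seq _) -> ~~ (eucl_dist x y < 2 * r) ->
    0 < eucl_dist x y - r <= eucl_dist x z.
  move=> _; rewrite -leNgt => xy.
  have : eucl_dist x y <= eucl_dist x z + eucl_dist z y :=
    eucl_dist_triangle z x y.
  by move=> tri; apply/andP; split; lra.
rewrite sumEFin (bigID (fun x => eucl_dist x y < 2 * r))/=.
rewrite [in leRHS](bigID (fun x => eucl_dist x y < 2 * r))/= EFinD.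
apply: leeD; last first.
  rewrite -sumEFin big_seq_cond [leRHS]big_seq_cond; apply: lee_sum.
  move=> x /andP[xw xfar]; have /andP[h0 h1] := far _ xw xfar.
  rewrite extend0_gt0E ?(lt_le_trans h0)// lee_fin.
  apply: le_trans (majorant_far f_riesz L1 r0 _); last by rewrite leNgt.
  exact: (riesz_like_anti f_riesz).
rewrite -[leLHS]big_filter -[in leRHS]big_filter -/xs.
have -> : \sum_(x <- xs) majorant f L r (eucl_dist x y) =
    near_bound f L r * (size xs)%:R.
  rewrite mulr_natr -iter_addr_0 -(count_predT xs) -big_const_seq.
  rewrite big_seq [RHS]big_seq; apply: eq_bigr => x.
  by rewrite mem_filter => /andP[xy _]; rewrite majorant_near// ltW.
have -> : (\sum_(x <- xs) extend0 f (eucl_dist x z) =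
    (\sum_(x <- xs) f (eucl_dist x z))%:E)%E.
  rewrite -sumEFin big_seq [RHS]big_seq; apply: eq_bigr => x /xz xz0.
  by rewrite extend0_gt0E.
rewrite lee_fin; apply: near_sum_le_bound => //.
rewrite -sumEFin; apply: (@le_trans _ _ (\sum_(x <- xs) extend0 f 0)%E).
  rewrite big_seq [leRHS]big_seq; apply: lee_sum => x /xz.
  exact: (le_extend0_0 f_riesz).
by rewrite big_const_seq count_predT iter_addr_0 muleC mule_natl.
Qed.

End discrete_potentials.

(** * Discretization of a measure *)

Section discretization.
Context {R : realType} {p : nat}.
Variables (d : R) (A : set 'rV[R]_p) (f : R -> R).
Hypotheses (A_compact : compact A) (A_neq0 : A !=set0)
  (f_riesz : riesz_like d f).
Variable mu : {measure set (borel_rV R p) -> \bar R}.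

(** Monotone convergence: the shifted kernels increase to the kernel, up to and
including its value at 0. *)
Lemma shifted_potential_cvg (y : 'rV[R]_p) :
  (\int[mu]_(x in A) (f (eucl_dist x y + n.+1%:R^-1))%:E)%E @[n --> \oo] -->
  potential A f mu y.
Proof.
have mA := compact_measurable_rV A_compact.
have dge x : 0 <= eucl_dist x y by exact: eucl_dist_ge0.
have npos n : 0 < n.+1%:R^-1 :> R by rewrite invr_gt0.
have := @cvg_monotone_convergence _ _ _ mu A mA
  (fun n (x : borel_rV R p) => (f (eucl_dist x y + n.+1%:R^-1))%:E).
move=> /(_ _ _ _)/wrap[| | |].
- by move=> n; exact: (measurable_shifted_kernel f_riesz).
- move=> n x _; rewrite lee_fin; apply/ltW/(riesz_like_gt0 f_riesz).
  by rewrite ltr_wpDl.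
- move=> x _ m n mn; rewrite lee_fin; apply: (riesz_like_anti f_riesz).
    by rewrite ltr_wpDl.
  by rewrite lerD2l lef_pV2 ?posrE// ler_nat.
congr (_ --> _); apply: eq_integral => x _.
by apply: cvg_lim => //; exact: (extend0_shift_cvg f_riesz).
Qed.

(** A Dini argument which needs no continuity of the potential: a shift by
[1 / (n + 1)] that works at [y] yields a shift by [1 / (m + 1)], for all
[m > 2 n], that works at all points within [1 / (2 n + 2)] of [y]. *)
Lemma uniform_shift (M : R) : (M%:E < polarization A f mu)%E ->
  exists2 delta : R, 0 < delta & forall y, A y ->
    (M%:E < \int[mu]_(x in A) (f (eucl_dist x y + delta))%:E)%E.
Proof.
move=> Mlt; have mA := compact_measurable_rV A_compact.
have npos n : 0 < n.+1%:R^-1 :> R by rewrite invr_gt0.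
have /compact_near_coveringP/(_ nat \oo
  (fun n y => (M%:E < \int[mu]_(x in A) (f (eucl_dist x y + n.+1%:R^-1))%:E)%E)) :=
  A_compact.
move=> /(_ _ _)/wrap[y Ay|[n _ /(_ n (leqnn n)) h]]; last first.
  by exists n.+1%:R^-1.
have Mpot : (M%:E < potential A f mu y)%E.
  by apply: (lt_le_trans Mlt); apply: ereal_inf_lbound; exists y.
have [n Mn] : exists n : nat,
    (M%:E < \int[mu]_(x in A) (f (eucl_dist x y + n.+1%:R^-1))%:E)%E.
  apply: contrapT => /forallNP h; move: Mpot; rewrite ltNge => /negP; apply.
  apply: (cvge_to_le (@shifted_potential_cvg y)); apply: nearW => n.
  by rewrite leNgt; exact/negP/h.
exists ([set y' | eucl_dist y' y < (n.*2.+2)%:R^-1], [set m | (n.*2 < m)%N]).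
  split => /=.
    have := @eucl_dist_continuous _ _ y y; rewrite /continuous_at eucl_distxx.
    by move/cvgr_lt; apply.
  by exists n.*2.+1.
move=> [y' m] [/= yy' nm]; apply: (lt_le_trans Mn).
apply: ge0_le_integral => //.
- move=> x _; rewrite lee_fin; apply/ltW/(riesz_like_gt0 f_riesz).
  by rewrite ltr_wpDl ?eucl_dist_ge0.
- exact: (measurable_shifted_kernel f_riesz).
- exact: (measurable_shifted_kernel f_riesz).
move=> x _; rewrite lee_fin; apply: (riesz_like_anti f_riesz).
  by rewrite ltr_wpDl ?eucl_dist_ge0.
have tri : eucl_dist x y' <= eucl_dist x y + eucl_dist y y' :=
  eucl_dist_triangle y x y'.
rewrite (eucl_distC y) in tri.
have m1 : m.+1%:R^-1 <= (n.*2.+2)%:R^-1 :> R.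
  by rewrite lef_pV2 ?posrE// ler_nat.
have n2 : (n.*2.+2)%:R^-1 = n.+1%:R^-1 / 2 :> R.
  by rewrite -doubleS -muln2 natrM invfM.
have yy : eucl_dist y' y < (n.*2.+2)%:R^-1 by exact: yy'.
apply: (le_trans (lerD tri m1)); rewrite -addrA lerD2l.
by rewrite [leRHS]splitr -n2 lerD2r ltW.
Qed.

Lemma finite_net (delta : R) : 0 < delta -> exists s : seq 'rV[R]_p,
  (forall a, a \in s -> A a) /\
  forall x, A x -> exists2 a, a \in s & eucl_dist x a < delta.
Proof.
move=> delta0; have := A_compact; rewrite compact_cover => cc.
have [|x Ax|D DA cov] := cc _ A (fun a => [set x | eucl_dist x a < delta]).
- move=> a _.
  have /continuousP/(_ [set t | t < delta]) := @eucl_dist_continuous _ _ a.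
  by apply; exact: open_lt.
- by exists x => //=; rewrite eucl_distxx.
exists (finmap.enum_fset D); split; first by move=> a /DA; rewrite inE.
by move=> x /cov[a aD xa]; exists a.
Qed.

Hypothesis mu1 : mu [set: _] = 1%E.

(** The cells are the balls of a [delta]-net made disjoint. If [x] lies in the
cell of [a j], then [a j] is at most [delta] further from [y] than [x] is, so
[f (eucl_dist x y + delta)] is at most the kernel at [a j]. The maximum with
[delta] keeps the latter finite. *)
Lemma cell_masses (delta : R) : 0 < delta ->
  exists (J : nat) (a : nat -> 'rV[R]_p) (m : nat -> R),
  [/\ forall j, (j < J)%N -> A (a j), forall j, 0 <= m j,
    \sum_(j < J) m j <= 1 &
    forall y, (\int[mu]_(x in A) (f (eucl_dist x y + delta))%:E <=
      (\sum_(j < J) f (Num.max (eucl_dist (a j) y) delta) * m j)%:E)%E].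
Proof.
move=> delta0; have [s [sA scov]] := finite_net delta0.
have mA := compact_measurable_rV A_compact.
pose a := nth 0 s; pose J := size s.
pose F (j : nat) : set (borel_rV R p) := A `&` [set x | eucl_dist x (a j) < delta].
have mF j : measurable (F j).
  apply: measurableI => //; apply: open_measurable_rV.
  have /continuousP/(_ [set t | t < delta]) := @eucl_dist_continuous _ _ (a j).
  by apply; exact: open_lt.
have mC j : measurable (seqDU F j) by exact: seqDU_measurable.
have muC j : mu (seqDU F j) \is a fin_num.
  rewrite ge0_fin_numE//; apply: (@le_lt_trans _ _ (mu setT)).
    by apply: le_measure; rewrite ?inE.
  by rewrite mu1 ltry.
exists J, a, (fun j => fine (mu (seqDU F j))); split.
- by move=> j jJ; apply: sA; exact: mem_nth.
- by move=> j; exact: fine_ge0.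
- rewrite -lee_fin -sumEFin; under eq_bigr do rewrite fineK//.
  rewrite -(@measure_bigsetU_ord _ _ _ mu J xpredT (fun j : 'I_J => seqDU F j))//.
    rewrite -mu1; apply: le_measure; rewrite ?inE//.
    exact: bigsetU_measurable.
  by move=> i j _ _ /(@trivIset_seqDU _ F _ _ I I)/ord_inj.
move=> y.
have g0 j : 0 <= f (Num.max (eucl_dist (a j) y) delta).
  by apply/ltW/(riesz_like_gt0 f_riesz); rewrite lt_max delta0 orbT.
pose h (j : nat) (x : borel_rV R p) : \bar R :=
  ((f (Num.max (eucl_dist (a j) y) delta))%:E * (\1_(seqDU F j) x)%:E)%E.
have h0 j x : (0 <= h j x)%E by rewrite mule_ge0// lee_fin.
have mh j : measurable_fun (A : set (borel_rV R p)) (h j).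
  by apply: measurable_funeM; apply/measurable_EFinP; exact: measurable_indic.
rewrite -sumEFin.
have -> : (\sum_(j < J) (f (Num.max (eucl_dist (a j) y) delta) *
    fine (mu (seqDU F j)))%:E = \int[mu]_(x in A) \sum_(j < J) h j x)%E.
  rewrite (ge0_integral_sum _ mA (f := fun j : 'I_J => h j))//.
  apply: eq_bigr => j _; rewrite EFinM fineK// /h.
  rewrite ge0_integralZl_EFin//; last first.
    by apply/measurable_EFinP; exact: measurable_indic.
  rewrite integral_indic// setIidl// => x [[]] //.
apply: ge0_le_integral => //.
- move=> x _; rewrite lee_fin; apply/ltW/(riesz_like_gt0 f_riesz).
  by rewrite ltr_wpDl ?eucl_dist_ge0.
- exact: (measurable_shifted_kernel f_riesz).
- exact: emeasurable_sum.
move=> x Ax.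
have [j [jJ Cjx]] : exists j, (j < J)%N /\ seqDU F j x.
  have [b bs xb] := scov _ Ax.
  have ex : exists j, (j < J)%N && (eucl_dist x (a j) < delta).
    by exists (index b s); rewrite index_mem bs/= /a nth_index.
  case: (ex_minnP ex) => j /andP[jJ' xj'] jmin.
  exists j; split => //; split; first by split.
  rewrite -bigcup_mkord => -[i /= ij [_ xi]].
  by have := jmin i; rewrite xi (ltn_trans ij)// => /(_ isT); rewrite leqNgt ij.
rewrite (bigD1 (Ordinal jJ))//=.
apply: (@le_trans _ _ (h j x)); last by rewrite leeDl// sume_ge0.
rewrite /h indicE mem_set// mule1 lee_fin; apply: (riesz_like_anti f_riesz).
  by rewrite lt_max delta0 orbT.
have [[_ xa] _] := Cjx.
rewrite ge_max; apply/andP; split; last by rewrite lerDr eucl_dist_ge0.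
have : eucl_dist (a j) y <= eucl_dist (a j) x + eucl_dist x y :=
  eucl_dist_triangle x (a j) y.
have : eucl_dist x (a j) < delta := xa.
rewrite (eucl_distC (a j) x); lra.
Qed.

(** Put about [N * m j] atoms at the centre [a j] of the [j]-th cell. Rounding
down loses at most one atom, hence at most [f delta / N], per cell. *)
Lemma discrete_polarization_ge (M : R) : (M%:E < polarization A f mu)%E ->
  \forall N \near \oo, (M%:E <= discrete_polarization A f N)%E.
Proof.
move=> Mlt.
have [M' MM' M'lt] : exists2 M' : R, M < M' & (M'%:E < polarization A f mu)%E.
  move: Mlt; case: (polarization A f mu) => [P|_|]//; last first.
    by exists (M + 1); rewrite ?ltry// ltrDl.
  by rewrite lte_fin => MP; exists ((M + P) / 2); rewrite ?lte_fin ?midf_lt.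
have [delta delta0 shift] := uniform_shift M'lt.
have [J [a [m [aA m0 m1 mint]]]] := cell_masses delta0.
have fd0 : 0 < f delta := riesz_like_gt0 f_riesz delta0.
pose g (y x : 'rV[R]_p) := f (Num.max (eucl_dist x y) delta).
have g0 x y : 0 <= g x y.
  by apply/ltW/(riesz_like_gt0 f_riesz); rewrite lt_max delta0 orbT.
have gfd x y : g x y <= f delta.
  by apply: (riesz_like_anti f_riesz) => //; rewrite le_max lexx orbT.
have gext x y : ((g y x)%:E <= extend0 f (eucl_dist x y))%E.
  have mx : 0 < Num.max (eucl_dist x y) delta by rewrite lt_max delta0 orbT.
  rewrite -(extend0_gt0E f mx); apply: (extend0_anti f_riesz).
    exact: eucl_dist_ge0.
  by rewrite le_max lexx.
have [a0 Aa0] := A_neq0.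
near=> N.
have N0 : (0 < N)%N by near: N; exact: nbhs_infty_gt.
have NR0 : 0 < N%:R :> R by rewrite ltr0n.
have Nbig : J%:R * f delta / (M' - M) <= N%:R by near: N; exact: nbhs_infty_ger.
pose n j := Num.truncn (N%:R * m j).
have nle j : (n j)%:R <= N%:R * m j by rewrite truncn_le ?mulr_ge0.
have nge j : N%:R * m j - 1 <= (n j)%:R.
  by rewrite lerBlDr natr1 ltW// truncnS_gt.
pose w0 := flatten [seq nseq (n j) (a j) | j <- iota 0 J].
have sw0 : (size w0 <= N)%N.
  rewrite size_flatten /shape -map_comp sumnE big_map.
  rewrite -(ler_nat R) natr_sum.
  have -> : \sum_(j <- iota 0 J) (size (nseq (n j) (a j)))%:R =
      \sum_(j < J) (n j)%:R :> R.
    rewrite -(big_mkord xpredT (fun j => (n j)%:R)) /index_iota subn0.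
    by apply: eq_bigr => j _; rewrite size_nseq.
  apply: (@le_trans _ _ (\sum_(j < J) N%:R * m j)).
    by apply: ler_sum => j _.
  by rewrite -mulr_sumr ger_pMr.
(* atoms at an arbitrary point of [A] make up for the rounding *)
pose w := w0 ++ nseq (N - size w0) a0.
have sw : size w == N by rewrite size_cat size_nseq subnKC.
have wA x : x \in w -> A x.
  rewrite mem_cat => /orP[/flattenP[_ /mapP[j + ->]]|]; rewrite mem_nseq.
    by rewrite mem_iota => /andP[_ jJ] /andP[_ /eqP ->]; exact: aA.
  by move=> /andP[_ /eqP ->].
apply: (@le_trans _ _ (polarization A f (counting_measure (Tuple sw)))); last first.
  apply: ereal_sup_ubound; exists (Tuple sw) => //= i.
  by apply: wA; rewrite -[w]/(tval (Tuple sw)) mem_tnth.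
apply: le_ereal_inf_tmp => _ [y Ay <-].
rewrite (potential_counting_measure A_compact f_riesz)//.
rewrite -lee_pdivrMl; last by rewrite invr_gt0.
rewrite invrK -EFinM.
apply: (@le_trans _ _ (\sum_(x <- w0) (g y x)%:E)%E); last first.
  rewrite [in leRHS]/= big_cat/=.
  apply: (@le_trans _ _ (\sum_(x <- w0) extend0 f (eucl_dist x y))%E).
    exact: lee_sum.
  rewrite leeDl// sume_ge0// => x _.
  by apply: (extend0_ge0 f_riesz); exact: eucl_dist_ge0.
rewrite sumEFin lee_fin.
have -> : \sum_(x <- w0) g y x = \sum_(j < J) (n j)%:R * g y (a j).
  rewrite -(big_mkord xpredT (fun j => (n j)%:R * g y (a j))).
  rewrite big_flatten big_map /index_iota subn0.
  apply: eq_bigr => j _.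
  by rewrite big_nseq iter_addr_0 mulr_natl.
have := lt_le_trans (shift _ Ay) (mint y); rewrite lte_fin => M'sum.
apply: (@le_trans _ _ (\sum_(j < J) (N%:R * (g y (a j) * m j) - f delta))); last first.
  apply: ler_sum => j _.
  apply: (@le_trans _ _ ((N%:R * m j - 1) * g y (a j))); last by apply: ler_wpM2r.
  have := gfd y (a j); rewrite mulrBl mul1r.
  have -> : N%:R * (g y (a j) * m j) = N%:R * m j * g y (a j) by ring.
  by move=> h; rewrite lerB.
rewrite sumrB -mulr_sumr sumr_const card_ord -[f delta *+ _]mulr_natl.
rewrite ler_pdivrMr ?subr_gt0// in Nbig.
have : N%:R * M' <= N%:R * \sum_(j < J) g y (a j) * m j.
  by apply: ler_wpM2l; exact: ltW.
rewrite mulrBr in Nbig.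
lra.
Unshelve. all: by end_near. Qed.

End discretization.

(** * Limits of optimal discrete measures *)

(** Reduces an inequality to finite levels, on which the weak limit acts. *)
Lemma le_ereal_of_lt_fin {R : realType} (a b : \bar R) :
  (forall M : R, (M%:E < a)%E -> (M%:E <= b)%E) -> (a <= b)%E.
Proof.
case: a => [a| |] h; last exact: leNye.
- apply/lee_subgt0Pr => e e0; apply: (h (a - e)).
  by rewrite lte_fin ltrBlDr ltrDl.
- case: b h => [b| |] h; last 2 first.
  + exact: lexx.
  + by have := h 0 (ltry _).
  by have := h (b + 1) (ltry _); rewrite lee_fin gerDl ler10.
Qed.

Section weak_limits.
Context {R : realType} {p : nat}.
Variables (d : R) (A : set 'rV[R]_p) (f : R -> R).
Hypotheses (d_gt0 : 0 < d) (A_compact : compact A) (f_riesz : riesz_like d f).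
Implicit Types mu nu : {measure set (borel_rV R p) -> \bar R}.

Let mA : measurable (A : set (borel_rV R p)) := compact_measurable_rV A_compact.

Lemma total_massE mu : supported_on A mu -> mu [set: _] = mu A.
Proof.
move=> muC; rewrite -(setUv A) measureU//; last by rewrite setICr.
  by rewrite -[RHS]adde0; congr (_ + _)%E; exact: muC.
exact: measurableC.
Qed.

Lemma eucl_dist_bounded (y : 'rV[R]_p) :
  exists2 D : R, 0 < D & forall x, A x -> eucl_dist x y <= D.
Proof.
have [s [_ cov]] := finite_net A_compact (@ltr01 R).
have s0 : 0 <= \sum_(a <- s) eucl_dist a y.
  by apply: sumr_ge0 => a _; exact: eucl_dist_ge0.
exists (1 + \sum_(a <- s) eucl_dist a y); first by rewrite ltr_wpDr.
move=> x /cov[a aS xa].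
have tri : eucl_dist x y <= eucl_dist x a + eucl_dist a y :=
  eucl_dist_triangle a x y.
apply: (le_trans tri); apply: lerD; first exact: ltW.
rewrite (big_rem a)//= lerDl.
by apply: sumr_ge0 => b _; exact: eucl_dist_ge0.
Qed.

(** Dominated convergence, with a multiple of the kernel itself as dominating
function; it is integrable by the hypothesis on the potential. *)
Lemma potential_majorant_cvg (L : R) nu (y : 'rV[R]_p) (r : nat -> R) :
  1 <= L -> (forall n, 0 < r n) -> r n @[n --> \oo] --> 0 ->
  (potential A f nu y < +oo)%E ->
  (\int[nu]_(x in A) (majorant f L (r n) (eucl_dist x y))%:E)%E @[n --> \oo]
    --> potential A f nu y.
Proof.
move=> L1 r0 rc pfin.
have [D D0 Dle] := eucl_dist_bounded y.
have [C C0 majle] := majorant_le_kernel f_riesz L1 D0.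
have k0 (x : borel_rV R p) : (0 <= extend0 f (eucl_dist x y))%E.
  by apply: (extend0_ge0 f_riesz); exact: eucl_dist_ge0.
have mk := @measurable_riesz_kernel _ _ _ f_riesz _ _ y mA.
have [] := @dominated_convergence _ _ _ nu A mA
  (fun n (x : borel_rV R p) => (majorant f L (r n) (eucl_dist x y))%:E)
  (fun x : borel_rV R p => extend0 f (eucl_dist x y))
  (fun x : borel_rV R p => (C%:E * extend0 f (eucl_dist x y))%E).
- by move=> n; exact: (measurable_majorant A_compact f_riesz).
- exact: mk.
- apply: nearW => x Ax; apply: (majorant_cvg f_riesz) => //.
  exact: eucl_dist_ge0.
- apply/integrableP; split; first exact: measurable_funeM.
  under eq_integral do rewrite gee0_abs ?mule_ge0//.
  by rewrite ge0_integralZl//; apply: lte_mul_pinfty.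
- apply: nearW => x n Ax; rewrite gee0_abs ?lee_fin ?(majorant_ge0 f_riesz)//.
  by apply: majle => //; [exact: eucl_dist_ge0|exact: Dle].
- by move=> _ _.
Qed.

Lemma attains_integral N nu (g : borel_rV R p -> \bar R) :
  attains_discrete A f N nu ->
  exists w : N.-tuple 'rV[R]_p, [/\ forall x, x \in (w : seq _) -> A x,
    polarization A f (counting_measure w) = discrete_polarization A f N &
    (\int[nu]_(x in A) g x = \int[counting_measure w]_(x in A) g x)%E].
Proof.
case=> -[w [wA nuw]] att; exists w; split.
- by move=> x /tnthP[i ->].
- rewrite -att; congr (ereal_inf _); apply: eq_imagel => y Ay.
  by apply/esym/eq_measure_integral => B mB _; exact: nuw.
- by apply: eq_measure_integral => B mB _; exact: nuw.
Qed.

Section subsequence.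
Variables (nu : nat -> {measure set (borel_rV R p) -> \bar R})
  (nu_star : {measure set (borel_rV R p) -> \bar R}).
Hypotheses
  (nu_attains : forall N : nat, (0 < N)%N -> attains_discrete A f N (nu N))
  (nu_star_on_A : supported_on A nu_star)
  (nu_star_limit : weak_star_limit A nu nu_star).

Lemma weak_star_limit_tail : exists sub : nat -> nat,
  (forall n, (n <= sub n)%N) /\
  forall g : 'rV[R]_p -> R, continuous g ->
    (\int[nu (sub n)]_(x in A) (g x)%:E)%E @[n --> \oo] -->
    (\int[nu_star]_(x in A) (g x)%:E)%E.
Proof.
have [sub [sub_incr lim]] := nu_star_limit; exists sub; split.
  by elim=> // n IH; exact: leq_ltn_trans IH (sub_incr _ _ (ltnSn n)).
by move=> g cg; apply: lim; apply: continuous_subspaceT => x; exact: cg.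
Qed.

Lemma weak_star_limit_ge (g : 'rV[R]_p -> R) (M : R) : continuous g ->
  (\forall N \near \oo, (M%:E <= \int[nu N]_(x in A) (g x)%:E)%E) ->
  (M%:E <= \int[nu_star]_(x in A) (g x)%:E)%E.
Proof.
move=> cg [N0 _ hN]; have [sub [sub_ge /(_ g cg) lim]] := weak_star_limit_tail.
apply: (cvge_to_ge lim); exists N0 => // n /= N0n; apply: hN => /=.
exact: leq_trans N0n (sub_ge n).
Qed.

Lemma weak_star_limit_le (g : 'rV[R]_p -> R) (M : R) : continuous g ->
  (\forall N \near \oo, (\int[nu N]_(x in A) (g x)%:E <= M%:E)%E) ->
  (\int[nu_star]_(x in A) (g x)%:E <= M%:E)%E.
Proof.
move=> cg [N0 _ hN]; have [sub [sub_ge /(_ g cg) lim]] := weak_star_limit_tail.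
apply: (cvge_to_le lim); exists N0 => // n /= N0n; apply: hN => /=.
exact: leq_trans N0n (sub_ge n).
Qed.

Lemma limit_mass : nu_star A = 1%E.
Proof.
have mass1 N : (0 < N)%N -> (\int[nu N]_(x in A) (cst 1 x)%:E = 1)%E.
  move=> N0; have [w [wA _ ->]] := attains_integral (EFin \o cst 1) (nu_attains N0).
  rewrite (integral_counting_measure A_compact _ _ wA)//=; last first.
    exact/measurable_EFinP/measurable_cst.
  rewrite big_const_seq count_predT iter_addr_0 size_tuple.
  have -> : (1%E *+ N)%R = ((N%:R)%:E * 1)%E :> \bar R by rewrite mule_natl.
  by rewrite mule1 -EFinM mulVf// pnatr_eq0 -lt0n.
have cc : continuous (cst 1 : 'rV[R]_p -> R) by move=> x; exact: cst_continuous.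
have -> : nu_star A = (\int[nu_star]_(x in A) (cst 1 x)%:E)%E.
  by rewrite -[LHS]mul1e -integral_cst.
apply/eqP; rewrite eq_le; apply/andP; split.
  by apply: weak_star_limit_le => //; exists 1%N => // N /= N0; rewrite mass1.
by apply: weak_star_limit_ge => //; exists 1%N => // N /= N0; rewrite mass1.
Qed.

Lemma limit_probability : probability_on A nu_star.
Proof.
by split => //; rewrite total_massE//; exact: limit_mass.
Qed.

(** An infinite potential is no obstacle, and otherwise the discretization of
[mu], the majorant at scale [r n] and the weak limit give the bound [M] for the
integral of each majorant, to which dominated convergence applies. *)
Lemma limit_potential_ge mu (y : 'rV[R]_p) : d_regular d A ->
  (0 < eucl_diam A)%E -> probability_on A mu -> A y ->
  (polarization A f mu <= potential A f nu_star y)%E.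
Proof.
move=> A_reg A_diam [mu1 _] Ay; apply: le_ereal_of_lt_fin => M Mlt.
have [->|pfin] := eqVneq (potential A f nu_star y) +oo%E; first exact: leey.
have {}pfin : (potential A f nu_star y < +oo)%E by rewrite ltey.
have [L0 [r1 [L0_gt0 r1_gt0 good]]] :=
  exists_good_point d_gt0 A_reg A_diam f_riesz.
pose L := Num.max 1 L0.
have L1 : 1 <= L by rewrite le_max lexx.
pose r (n : nat) := r1 * n.+1%:R^-1.
have r0 n : 0 < r n by rewrite mulr_gt0// invr_gt0.
have rr1 n : r n <= r1 by rewrite ler_piMr ?(ltW r1_gt0)// invf_le1 ?ler1n.
have rc : r n @[n --> \oo] --> 0.
  by rewrite -(mulr0 r1); apply: cvgMr; exact: cvg_harmonic.
apply: (cvge_to_ge (potential_majorant_cvg L1 r0 rc pfin)).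
apply: nearW => n.
apply: weak_star_limit_ge; first exact: (majorant_dist_continuous f_riesz).
have An0 : A !=set0 by exists y.
have := discrete_polarization_ge A_compact An0 f_riesz mu1 Mlt.
move=> [N0 _ hN]; exists (maxn 1 N0) => // N /=; rewrite geq_max => /andP[N1 NN].
have [w [wA weq ->]] := attains_integral
  (fun x : borel_rV R p => (majorant f L (r n) (eucl_dist x y))%:E) (nu_attains N1).
apply: (polarization_le_integral_majorant A_compact f_riesz L1 (r1 := r1)) => //.
  move=> s xs s0 sr1 xsA; have [z [Az zy xz Sle]] := good y s xs Ay s0 sr1 xsA.
  exists z; split => //; apply: (le_trans Sle); apply: ler_wpM2r => //.
  apply: ler_wpM2r; first exact/ltW/(riesz_like_gt0 f_riesz).
  by rewrite le_max lexx orbT.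
by rewrite weq; apply: hN.
Qed.

End subsequence.

(** A set of diameter 0 carries a single probability measure. *)
Lemma singleton_potential_ge mu nu (y : 'rV[R]_p) : (eucl_diam A <= 0)%E ->
  mu A = 1%E -> nu A = 1%E -> A y ->
  (polarization A f mu <= potential A f nu y)%E.
Proof.
move=> A_diam mu1 nu1 Ay.
have Aeq x : A x -> x = y.
  move=> Ax; apply: eucl_dist0_eq; apply/eqP.
  rewrite eq_le eucl_dist_ge0 andbT -lee_fin.
  exact: le_trans (eucl_dist_le_diam Ax Ay) A_diam.
suff -> : potential A f nu y = potential A f mu y.
  by apply: ereal_inf_lbound; exists y.
apply: eq_measure_integral => B mB BA.
have [->|/set0P[b Bb]] := eqVneq B set0; first by rewrite !measure0.
have -> : B = A; last by rewrite mu1 nu1.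
apply/seteqP; split => // x Ax.
by rewrite (Aeq _ Ax) -(Aeq _ (BA _ Bb)).
Qed.

End weak_limits.

Theorem theorem1p9 (R : realType) (p : nat) (d : R) (A : set 'rV[R]_p)
    (f : R -> R)
    (nu : nat -> {measure set (borel_rV R p) -> \bar R})
    (nu_star : {measure set (borel_rV R p) -> \bar R})
    (d_gt0 : 0 < d) (d_le_p : d <= p%:R)
    (A_regular : d_regular d A) (f_riesz : riesz_like d f)
    (nu_attains : forall N : nat, (0 < N)%N -> attains_discrete A f N (nu N))
    (nu_star_on_A : supported_on A nu_star)
    (nu_star_limit : weak_star_limit A nu nu_star) :
  solves_polarization A f nu_star.
Proof.
have [_ A_compact _] := A_regular.
have nu_star1 := limit_mass A_compact nu_attains nu_star_limit.
have nu_star_prob :=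
  limit_probability A_compact nu_attains nu_star_on_A nu_star_limit.
split => //; apply/eqP; rewrite eq_le; apply/andP; split.
  by apply: ereal_sup_ubound; exists nu_star.
apply: ge_ereal_sup => _ [mu mu_prob <-].
apply: le_ereal_inf_tmp => _ [y Ay <-].
have [A_diam|A_diam] := leP (eucl_diam A) 0%E; last first.
  exact: (limit_potential_ge d_gt0 A_compact f_riesz nu_attains).
apply: (singleton_potential_ge _ A_diam) => //.
have [mu1 muC] := mu_prob.
by rewrite -(total_massE A_compact muC).
Qed.
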